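(* All codes below are $q$-ary Singleton-optimal $[n,k,d;r]$-locally repairable codes ($q$ a prime power) with $r<k$, $n\ge 2(r+1)$, $d\ge 3$. The following hold. (i) $n=O(q)$ if $d$ is proportional to $n$: for every real $\lambda\in(0,1)$ there is a constant $C_\lambda$ such that every such code with $d=\lambda n$ satisfies $n\le C_\lambda q$. (ii) Suppose the Main MDS Conjecture holds. If $k$ is a constant and $k\not\equiv 1\pmod r$, then $n\le q+O(1)$: for every $k$ there is a constant $C_k$ such that every such code of dimension $k$ with $k\not\equiv1\pmod r$ satisfies $n\le q+C_k$. (iii) If $r+2-\{k \pmod r\}<d<r+2$, then $n<\frac{(d+r)(r-1+(d-2)r)}{r-d+2}$. In particular $n=O(1)$ if both $r$ and $d$ are constant. (iv) Let $d\ge 5$, and suppose $dr=o(n)$ (i.e. consider a sequence of such codes, with $q,n,k,d,r$ possibly all varying, along which $dr/n\to0$). Put $t=\{d \pmod 4\}$ and $\epsilon=\{k\pmod r\}/r$. Then $$n\le (1+o(1))\,\frac{r+1}{r}\cdot\frac{d-1}{4(q-1)}\cdot\min\left\{q^{\frac{4r(d-1-\epsilon)}{(d-t)(r+1)}},\,q^{\frac{4(d-2)}{d-t}}\right\}\quad\text{if } d\equiv 1,2\pmod 4,$$ $$n\le (1+o(1))\,\frac{r+1}{r}\cdot\frac{d-1}{4(q-1)}\cdot\min\left\{q^{\frac{4r(d-2-\epsilon)}{(d-t)(r+1)}},\,q^{\frac{4(d-3)}{d-t}}\right\}\quad\text{if } d\equiv 3,4\pmod 4,$$ where the $o(1)$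 terms tend to $0$ along the sequence. (v) For $d=5,6,7$ (implied constants absolute; ''$r=o(n)$'' means along a sequence of such codes with $r/n\to 0$): $d=5$: $n=O(1)$ if $r=1$; $n=O(q)$ if $r\in\{2,3\}$; $n=O(r)$ if $r\ge4$ and $k\equiv 0,-1,-2\pmod r$; $n=O(q^2)$ if $r\ge 4$ and $r=o(n)$. $d=6$: $n=O(q)$ if $r=1$; $n=O(q)$ if $r=2$ and $k\equiv0\pmod2$; $n=O(q^2)$ if $r=2$ and $k\equiv 1\pmod 2$; $n=O(q^2)$ if $r\in\{3,4\}$; $n=O(r)$ if $r\ge 5$ and $k\equiv 0,-1,-2,-3\pmod r$; $n=O\big(q^{\frac{4r-2}{r+1}}\big)$ if $r\ge5$ and $r=o(n)$. $d=7$: $n=O(1)$ if $r=1$; $n=O(q)$ if $r=2$; $n=O(q)$ if $r=3$ and $k\equiv 0\pmod 3$; $n=O(q^2)$ if $r=3$ and $k\not\equiv0\pmod3$; $n=O(q^2)$ if $r\in\{4,5\}$; $n=O(r)$ if $r\ge6$ and $k\equiv-1,-2,-3,-4\pmod r$; $n=O\big(q^{\frac{4r-2}{r+1}}\big)$ if $r\ge 6$ and $r=o(n)$.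
   Context: An $[n,k,d;r]$-locally repairable code over $\mathbb{F}_q$ is a linear code $\mathcal{C}\subseteq\mathbb{F}_q^n$ of dimension $k$ and minimum Hamming distance $d$ with locality $r$ ($r\ge1$): for every $i\in[n]=\{1,\dots,n\}$ there is $I_i\subseteq[n]\setminus\{i\}$ with $|I_i|\le r$ such that any two codewords agreeing on $I_i$ also agree at $i$. For linear codes this is equivalent to: for every $i\in[n]$ there is $\mathbf{c}\in\mathcal{C}^\perp$ with $i\in\mathrm{supp}(\mathbf{c})$ and $|\mathrm{supp}(\mathbf{c})|\le r+1$. Such a code always satisfies $d\le n-k-\lceil k/r\rceil+2$ (Singleton-type bound) and is called Singleton-optimal if equality holds. For integers $\ell$ and $m\ge1$, $\{\ell\pmod m\}$ denotes the remainder $s\equiv \ell\pmod m$ with $1\le s\le m$. Main MDS Conjecture: an $[n,k]$ linear code over $\mathbb{F}_q$ is MDS if its minimum distance is $n-k+1$, and nontrivial if $k\notin\{0,1,n-1,n\}$; the conjecture asserts that every nontrivial $[n,k]$ MDS code over $\mathbb{F}_q$ has $n\le q+2$ if $q$ is even and $k=3$ or $k=q-1$, and $n\le q+1$ otherwise. *)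

(* Defs.v *)
From HB Require Import structures.
From mathcomp Require Import all_boot all_order all_algebra.
From mathcomp Require Import all_classical all_reals all_analysis.

Set Implicit Arguments.
Unset Strict Implicit.
Unset Printing Implicit Defensive.

Import Order.TTheory GRing.Theory Num.Theory.
Import numFieldNormedType.Exports.

Local Open Scope classical_set_scope.
Local Open Scope ring_scope.

Definition hamming_dist (F : finFieldType) (n : nat) (u v : 'rV[F]_n) : nat :=
  #|[set i : 'I_n | u 0 i != v 0 i]%SET|.

(* The minimum is over pairs of distinct codewords, so the zero code has no
   minimum distance at all. *)
Definition has_min_dist (F : finFieldType) (n : nat)
    (C : {vspace 'rV[F]_n}) (d : nat) : Prop :=
  (exists u v : 'rV[F]_n,
     [/\ u \in C, v \in C, u != v & hamming_dist u v = d])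
  /\ (forall u v : 'rV[F]_n,
        u \in C -> v \in C -> u != v -> (d <= hamming_dist u v)%N).

(* The integer r is only an upper bound on the size of the repair sets. *)
Definition has_locality (F : finFieldType) (n : nat)
    (C : {vspace 'rV[F]_n}) (r : nat) : Prop :=
  forall i : 'I_n, exists I : {set 'I_n},
    [/\ i \notin I, (#|I| <= r)%N &
        forall u v : 'rV[F]_n, u \in C -> v \in C ->
          (forall j, j \in I -> u 0 j = v 0 j) -> u 0 i = v 0 i].

Definition is_lrc (F : finFieldType) (n k d r : nat)
    (C : {vspace 'rV[F]_n}) : Prop :=
  [/\ (1 <= r)%N, \dim C = k, has_min_dist C d & has_locality C r].

Definition singleton_optimal (n k d r : nat) : Prop :=
  d%:Z = n%:Z - k%:Z - Num.ceil (k%:R / r%:R : rat) + 2.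

(* A Singleton-optimal locally repairable code over some finite field, bundled
   with its parameters and with the standing assumptions on them. *)
Record opt_lrc := OptLRC {
  lrc_field : finFieldType;
  lrc_n : nat;
  lrc_k : nat;
  lrc_d : nat;
  lrc_r : nat;
  lrc_code : {vspace 'rV[lrc_field]_lrc_n};
  lrc_axiom : is_lrc lrc_k lrc_d lrc_r lrc_code;
  lrc_optimal : singleton_optimal lrc_n lrc_k lrc_d lrc_r;
  lrc_r_lt_k : (lrc_r < lrc_k)%N;
  lrc_n_ge : (2 * (lrc_r + 1) <= lrc_n)%N;
  lrc_d_ge3 : (3 <= lrc_d)%N
}.

Definition lrc_q (c : opt_lrc) : nat := #|lrc_field c|.

(* {l (mod m)}: the remainder of l modulo m taken in 1, ..., m (for m > 0). *)
Definition rem1 (l m : nat) : nat := if (m %| l)%N then m else (l %% m)%N.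

Definition congr_any (l m : nat) (s : seq int) : bool :=
  has (fun a : int => (l%:Z == a %[mod m%:Z])%Z) s.

Definition is_MDS (F : finFieldType) (n : nat) (C : {vspace 'rV[F]_n}) : Prop :=
  has_min_dist C (n - \dim C + 1)%N.

Definition main_MDS_conjecture : Prop :=
  forall (F : finFieldType) (n : nat) (C : {vspace 'rV[F]_n}),
    let q := #|F| in
    let k := \dim C in
    k \notin [:: 0; 1; n.-1; n]%N -> is_MDS C ->
    (n <= if ~~ odd q && ((k == 3) || (k == q.-1)) then q + 2 else q + 1)%N.

(* n = O(b) on the class of codes P, with one constant for the whole class. *)
Definition length_bigO (R : realType) (P : opt_lrc -> Prop)
    (b : opt_lrc -> R) : Prop :=
  exists K : R, forall c : opt_lrc, P c -> (lrc_n c)%:R <= K * b c.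

(* n = O(b) on P when r = o(n). The constant does not depend on the sequence,
   hence the bound can only be required from some index on. *)
Definition length_bigO_small_r (R : realType) (P : opt_lrc -> Prop)
    (b : opt_lrc -> R) : Prop :=
  exists K : R, forall s : nat -> opt_lrc,
    (forall i, P (s i)) ->
    ((lrc_r (s i))%:R / (lrc_n (s i))%:R : R) @[i --> \oo] --> (0 : R) ->
    \forall i \near \oo, (lrc_n (s i))%:R <= K * b (s i).

(* Main.v *)
(** The dual code contains words of weight at most r + 1 covering all
    coordinates; chosen greedily, l >= n / (r + 1) of them are independent, each
    with a pivot outside the supports of the earlier ones. Put h = ceil (k / r).

    Shortening the code at the union of h - 1 (or h - 2) of the supports leaves
    a code containing a two-dimensional subcode supported on d + 1 (or d + 2)
    coordinates, and counting zeros gives d <= q (or d <= 2 q). This yields (i),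
    and (ii) even without the MDS conjecture.

    Shortening at h supports shows that any h of them waste at most u = h r - k
    of the h (r + 1) places, whereas the l supports waste l (r + 1) - n in total;
    averaging over subfamilies gives (iii).

    On the coordinates covered once, differences of two columns of the same
    support are free of local checks, so about n r / (r + 1) such differences
    form the parity-check columns of a code with only m = n - k - l checks and
    distance at least d / 2. Its Hamming bound gives (iv) and the rest of (v). *)

Require Import Defs.
From HB Require Import structures.
From mathcomp Require Import all_boot all_order all_algebra all_field.
From mathcomp Require Import zify ring lra.

Set Implicit Arguments.
Unset Strict Implicit.
Unset Printing Implicit Defensive.

Import Order.TTheory GRing.Theory Num.Theory.

Local Open Scope ring_scope.

(** * Local checks and shortening *)

Definition dotr (F : finFieldType) (n : nat) (y x : 'rV[F]_n) : F :=
  \sum_i y 0 i * x 0 i.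

Definition wsupp (F : finFieldType) (n : nat) (x : 'rV[F]_n) : {set 'I_n} :=
  [set i | x 0 i != 0].

Lemma wsuppPn (F : finFieldType) (n : nat) (x : 'rV[F]_n) i :
  i \notin wsupp x -> x 0 i = 0.
Proof. by rewrite inE negbK => /eqP. Qed.

(** Locality makes column [i] of a generator matrix a combination of the columns indexed by [I]; the
    coefficients of this linear relation form the dual word. *)
Lemma exists_dual_word (F : finFieldType) (n r : nat) (C : {vspace 'rV[F]_n}) :
  has_locality C r ->
  forall i, exists y : 'rV[F]_n,
    [/\ forall c, c \in C -> dotr y c = 0, i \in wsupp y & (#|wsupp y| <= r.+1)%N].
Proof.
move=> locC i; have [I [iNI cardI locI]] := locC i.
pose G : 'M[F]_(\dim C, n) := \matrix_j (vbasis C)`_j.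
have GC (x : 'rV_(\dim C)) : x *m G \in C.
  rewrite mulmx_sum_row; apply: memv_suml => j _; apply: memvZ.
  by rewrite rowK; apply: vbasis_mem; apply: mem_nth; rewrite size_tuple.
have CG c : c \in C -> exists x, c = x *m G.
  move=> /coord_vbasis ->; exists (\row_j coord (vbasis C) j c).
  by rewrite mulmx_sum_row; apply: eq_bigr => j _; rewrite rowK mxE.
pose P : 'M[F]_n := diag_mx (\row_j (j \in I)%:R).
pose M := (G *m P)^T; pose K := cokermx M.
(* Membership in the row space of [M] is tested on the columns of its cokernel: each one yields a
   codeword [c] vanishing on [I], and locality, applied to [c] and 0, gives [c 0 i = 0]. *)
have : ((col i G)^T <= M)%MS.
  rewrite submxE -/K; apply/eqP/rowP=> b.
  pose c := row b K^T *m G.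
  have cI j : j \in I -> c 0 j = (0 : 'rV_n) 0 j.
    move=> jI; have /rowP/(_ j) : c *m P = 0.
      by rewrite /c -mulmxA -row_mul -[G *m P]trmxK -trmx_mul mulmx_coker trmx0 row0.
    have -> : (c *m P) 0 j = c 0 j * (j \in I)%:R.
      by rewrite mul_mx_diag mxE [in X in _ * X]mxE.
    by rewrite jI mulr1.
  have -> : ((col i G)^T *m K) 0 b = c 0 i.
    rewrite [LHS]mxE [RHS]mxE; apply: eq_bigr => a _.
    by rewrite [(col i G)^T _ _]mxE [col i G _ _]mxE [row b _ _ _]mxE [K^T _ _]mxE mulrC.
  by rewrite (locI c 0 (GC _) (mem0v _) cI) [LHS]mxE [RHS]mxE.
case/submxP=> z zM.
pose y : 'rV[F]_n := delta_mx 0 i - z *m P.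
have yE j : y 0 j = (j == i)%:R - z 0 j * (j \in I)%:R.
  rewrite !mxE (bigD1 j) //= big1 ?addr0 => [|h hj]; first by rewrite !mxE eqxx mulr1n.
  by rewrite !mxE (negPf hj) mulr0n mulr0.
exists y; split.
- move=> _ /CG[x ->].
  have -> : dotr y (x *m G) = (x *m (G *m y^T)) 0 0.
    by rewrite mulmxA mxE; apply: eq_bigr => j _; rewrite mulrC [y^T _ _]mxE.
  have -> : G *m y^T = 0.
    rewrite /y linearB /= mulmxBr trmx_mul tr_diag_mx mulmxA trmx_delta.
    have -> : G *m P *m z^T = (z *m M)^T by rewrite trmx_mul trmxK.
    rewrite -zM trmxK; apply/eqP; rewrite subr_eq0; apply/eqP/matrixP=> a b.
    rewrite !mxE (bigD1 i) //= big1 ?addr0; last first.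
      by move=> h hi; rewrite !mxE (negPf hi) mulr0.
    by rewrite !mxE eqxx ord1 eqxx mulr1.
  by rewrite mulmx0 mxE.
- by rewrite inE yE eqxx (negPf iNI) mulr0 subr0 oner_eq0.
- apply: leq_trans (_ : #|i |: I| <= _)%N; last by rewrite cardsU1 iNI.
  apply: subset_leq_card; apply/subsetP=> j; rewrite !inE yE.
  by case: (j == i) => //=; case: (j \in I) => //=; rewrite mulr0 subr0 eqxx.
Qed.

(** The families are indexed by [nat], so that adding a check only raises [l]. Fresh pivots make the
    checks triangular, which encodes their independence. *)
Record local_checks (F : finFieldType) (n : nat) (C : {vspace 'rV[F]_n})
    (r l : nat) (y : nat -> 'rV[F]_n) (p : nat -> 'I_n) : Prop := LocalChecks {
  lc_orth : forall j c, (j < l)%N -> c \in C -> dotr (y j) c = 0;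
  lc_weight : forall j, (j < l)%N -> (#|wsupp (y j)| <= r.+1)%N;
  lc_pivot : forall j, (j < l)%N -> p j \in wsupp (y j);
  lc_fresh : forall i j, (i < j)%N -> (j < l)%N -> p j \notin wsupp (y i) }.

Lemma pivot_inj (F : finFieldType) (n : nat) (C : {vspace 'rV[F]_n})
    (r l : nat) (y : nat -> 'rV[F]_n) (p : nat -> 'I_n) :
  local_checks C r l y p -> injective (fun j : 'I_l => p j).
Proof.
move=> H i j pij; apply/val_inj/eqP; case: ltngtP => // lij.
- by have := lc_fresh H lij (ltn_ord j); rewrite -pij (lc_pivot H).
- by have := lc_fresh H lij (ltn_ord i); rewrite pij (lc_pivot H).
Qed.

(** Greedy choice: a dual word through an uncovered coordinate extends the family, with that
    coordinate as its pivot. Pivots are distinct, so at most [n] checks can be collected. *)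
Lemma exists_covering_checks (F : finFieldType) (n r : nat)
    (C : {vspace 'rV[F]_n}) : (0 < n)%N -> has_locality C r ->
  exists l y p, local_checks C r l y p /\
    forall i, exists2 j, (j < l)%N & i \in wsupp (y j).
Proof.
move=> n0 /exists_dual_word dual.
have ext l y p : local_checks C r l y p ->
    (exists i, forall j, (j < l)%N -> i \notin wsupp (y j)) ->
    exists y' p', local_checks C r l.+1 y' p'.
  move=> H [i iN]; have [z [zC iz wz]] := dual i.
  exists (fun j => if j == l then z else y j).
  exists (fun j => if j == l then i else p j).
  split=> [j c|j|j|i0 j].
  - by rewrite ltnS leq_eqVlt; case: eqP => [_ _|_ /= jl]; [exact: zC|exact: (lc_orth H jl)].
  - by rewrite ltnS leq_eqVlt; case: eqP => [_ _|_ /= jl]; [exact: wz|exact: (lc_weight H jl)].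
  - by rewrite ltnS leq_eqVlt; case: eqP => [_ _|_ /= jl]; [exact: iz|exact: (lc_pivot H jl)].
  - move=> ij; rewrite ltnS => jl; have -> : (i0 == l) = false by lia.
    case: eqP => [e|/eqP e]; first by apply: iN; lia.
    by apply: (lc_fresh H) => //; rewrite ltn_neqAle e.
have max l : (exists y p, local_checks C r l y p) -> (l <= n)%N.
  move=> [y [p H]]; have := max_card (mem (codom (fun j : 'I_l => p j))).
  by rewrite card_codom ?card_ord //; exact: (pivot_inj H).
suff gen m l : (exists y p, local_checks C r l y p) -> (n - l <= m)%N ->
    exists l y p, local_checks C r l y p /\
      forall i, exists2 j, (j < l)%N & i \in wsupp (y j).
  apply: (gen n 0); last exact: leq_subr.
  by exists (fun _ => 0), (fun _ => Ordinal n0); split=> *; lia.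
elim: m l => [|m IHm] l [y [p H]] lm.
- case: (boolP [exists i, [forall j : 'I_l, i \notin wsupp (y j)]]).
    move=> /existsP[i /forallP iN]; case: (ext _ _ _ H).
      by exists i => j jl; exact: (iN (Ordinal jl)).
    by move=> y' [p' H']; have := max l.+1 (ex_intro _ y' (ex_intro _ p' H')); lia.
  rewrite negb_exists => /forallP cov; exists l, y, p; split=> // i.
  by have := cov i; rewrite negb_forall => /existsP[j]; rewrite negbK; exists j.
- case: (boolP [exists i, [forall j : 'I_l, i \notin wsupp (y j)]]).
    move=> /existsP[i /forallP iN]; apply: (IHm l.+1); last by lia.
    by apply: (ext _ _ _ H); exists i => j jl; exact: (iN (Ordinal jl)).
  rewrite negb_exists => /forallP cov; exists l, y, p; split=> // i.
  by have := cov i; rewrite negb_forall => /existsP[j]; rewrite negbK; exists j.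
Qed.

(* Each check expresses its pivot through coordinates that are either free or
   pivots of earlier checks. *)
Lemma pivots_vanish (F : finFieldType) (n : nat) (C : {vspace 'rV[F]_n})
    (r l : nat) (y : nat -> 'rV[F]_n) (p : nat -> 'I_n)
    (Q : pred 'I_l) (A : {set 'I_n}) (x : 'rV[F]_n) :
  local_checks C r l y p ->
  (forall j, Q j -> wsupp (y j) \subset A) ->
  (forall j, Q j -> dotr (y j) x = 0) ->
  (forall i, i \in A -> (forall j, Q j -> i != p j) -> x 0 i = 0) ->
  forall i, i \in A -> x 0 i = 0.
Proof.
move=> H QA Qx xA.
suff piv m : forall j : 'I_l, (j < m)%N -> Q j -> x 0 (p j) = 0.
  move=> i iA; case: (boolP [exists j, Q j && (i == p j)]).
    by move=> /existsP[j /andP[Qj /eqP->]]; apply: (piv l).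
  rewrite negb_exists => /forallP Hi; apply: xA => // j Qj.
  by have := Hi j; rewrite Qj.
elim: m => // m IHm j; rewrite ltnS => jm Qj.
have := Qx j Qj; rewrite /dotr (bigD1 (p j)) //= big1 => [|i ij].
  rewrite addr0 => /eqP; rewrite mulf_eq0 => /orP[|/eqP//].
  by have := lc_pivot H (ltn_ord j); rewrite inE => /negPf->.
case: (boolP (i \in wsupp (y j))) => [iy|/wsuppPn->]; last by rewrite mul0r.
have iA := subsetP (QA _ Qj) _ iy.
case: (boolP [exists h, Q h && (i == p h)]).
  move=> /existsP[h /andP[Qh /eqP ih]].
  case: (ltngtP h j) => hj.
  - by rewrite ih IHm ?mulr0 //; lia.
  - by have := lc_fresh H hj (ltn_ord h); rewrite -ih iy.
  - by move: ij; rewrite ih (val_inj hj) eqxx.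
rewrite negb_exists => /forallP Hi; rewrite xA ?mulr0 // => h Qh.
by have := Hi h; rewrite Qh.
Qed.

Lemma vanishing_subcode (F : finFieldType) (n : nat) (C : {vspace 'rV[F]_n})
    (A : {set 'I_n}) :
  exists V : {vspace 'rV[F]_n},
    [/\ (V <= C)%VS, forall x, x \in V -> forall i, i \in A -> x 0 i = 0 &
        (\dim C <= \dim V + #|A|)%N].
Proof.
pose M : 'M[F]_(n, #|A|) := \matrix_(i, j) (i == enum_val j)%:R.
pose f : 'Hom('rV[F]_n, 'rV[F]_#|A|) := linfun (mulmxr M).
have fE x j : f x 0 j = x 0 (enum_val j).
  rewrite lfunE /= mxE (bigD1 (enum_val j)) //= big1 => [|h hj].
    by rewrite mxE eqxx mulr1 addr0.
  by rewrite mxE (negPf hj) mulr0.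
exists (C :&: lker f)%VS; split; first exact: capvSl.
- move=> x; rewrite memv_cap memv_ker => /andP[_ /eqP/rowP xf] i iA.
  by have := xf (enum_rank_in iA i); rewrite fE enum_rankK_in // mxE.
- rewrite -(limg_ker_dim f C) leq_add2l (leq_trans (dimvS (subvf _))) //.
  by rewrite dimvf /dim /= mul1n.
Qed.

(** It suffices to vanish on [A] minus the pivots of [Q], since the checks then force the pivots to
    vanish too; each check inside [A] saves one dimension. *)
Lemma shortened_subcode (F : finFieldType) (n : nat) (C : {vspace 'rV[F]_n})
    (r l : nat) (y : nat -> 'rV[F]_n) (p : nat -> 'I_n)
    (Q : {set 'I_l}) (A : {set 'I_n}) :
  local_checks C r l y p -> (forall j, j \in Q -> wsupp (y j) \subset A) ->
  exists V : {vspace 'rV[F]_n},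
    [/\ (V <= C)%VS, forall x, x \in V -> forall i, i \in A -> x 0 i = 0 &
        (\dim C + #|Q| <= \dim V + #|A|)%N].
Proof.
move=> H QA; pose pQ := [set p (val j) | j in Q].
have [V [VC VA dimV]] := vanishing_subcode C (A :\: pQ).
exists V; split=> //.
  move=> x xV; apply: (pivots_vanish (Q := mem Q) H QA) => [j jQ|i iA iN].
    by apply: (lc_orth H) => //; exact: (subvP VC).
  apply: VA => //; rewrite inE iA andbT; apply/imsetP=> -[j jQ ij].
  by move: (iN j jQ); rewrite ij eqxx.
have pQA : pQ \subset A.
  by apply/subsetP=> _ /imsetP[j jQ ->]; exact: (subsetP (QA _ jQ) _ (lc_pivot H (ltn_ord j))).
rewrite -(cardsID pQ A) (setIidPr pQA) card_imset; last exact: (pivot_inj H).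
by rewrite addnCA addnC leq_add2l.
Qed.

Lemma leq_min_dist (F : finFieldType) (n d : nat) (C : {vspace 'rV[F]_n}) x :
  has_min_dist C d -> x \in C -> x != 0 -> (d <= #|wsupp x|)%N.
Proof.
move=> [_ dC] xC x0; apply: leq_trans (dC x 0 xC (mem0v _) x0) _.
by apply: subset_leq_card; apply/subsetP=> i; rewrite !inE mxE.
Qed.

Lemma leq_card_bigcup (I T : finType) (P : pred I) (S : I -> {set T}) :
  (#|\bigcup_(i | P i) S i| <= \sum_(i | P i) #|S i|)%N.
Proof.
apply: (big_ind2 (fun (A : {set T}) m => #|A| <= m)%N) => [|A a B b hA hB|//].
  by rewrite cards0.
by rewrite (leq_trans (leq_card_setU _ _)) // leq_add.
Qed.

Lemma exists_superset_card (T : finType) (U : {set T}) (t : nat) :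
  (#|U| <= t <= #|T|)%N -> exists A : {set T}, U \subset A /\ #|A| = t.
Proof.
elim: t => [|t IHt]; first by rewrite leqn0 andbT => /eqP U0; exists U.
rewrite leq_eqVlt => /andP[/orP[/eqP Ut _|Ut tT]]; first by exists U.
have [|A [UA At]] := IHt; first by move: Ut tT; lia.
have /subsetPn[x _ xA] : ~~ ([set: T] \subset A).
  by apply/negP=> /subset_leq_card; rewrite cardsT At; lia.
exists (x |: A); rewrite cardsU1 xA At; split=> //.
by apply: subset_trans UA (subsetUr _ _).
Qed.

Lemma exists_subset_card (T : finType) (t : nat) :
  (t <= #|T|)%N -> exists A : {set T}, #|A| = t.
Proof.
by move=> tT; have [|A []] := @exists_superset_card T set0 t; [rewrite cards0|exists A].
Qed.

Lemma wsupp_subC (F : finFieldType) (n : nat) (x : 'rV[F]_n) (A : {set 'I_n}) :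
  (forall i, i \in A -> x 0 i = 0) -> wsupp x \subset ~: A.
Proof.
move=> xA; apply/subsetP=> i; rewrite !inE; apply: contra => iA.
by rewrite xA.
Qed.

(** Otherwise the union can be padded to [\dim C - 1 + #|Q|] coordinates, and shortening there
    leaves a nonzero word of weight at most [n + 1 - \dim C - #|Q|], which is below [d]. *)
Lemma checks_union_ge (F : finFieldType) (n d r l : nat) (C : {vspace 'rV[F]_n})
    (y : nat -> 'rV[F]_n) (p : nat -> 'I_n) (Q : {set 'I_l}) :
  local_checks C r l y p -> has_min_dist C d ->
  (0 < \dim C)%N -> (\dim C + #|Q| <= n)%N -> (n.+1 < d + \dim C + #|Q|)%N ->
  (\dim C + #|Q| <= #|\bigcup_(j in Q) wsupp (y j)|)%N.
Proof.
move=> H dC k0 kQn dkQ; rewrite leqNgt; apply/negP=> Ulow.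
have [|A [UA cardA]] := @exists_superset_card _
    (\bigcup_(j in Q) wsupp (y j)) ((\dim C).-1 + #|Q|).
  by rewrite card_ord; lia.
have [|V [VC VA dimV]] := @shortened_subcode _ _ _ _ _ _ _ Q A H.
  by move=> j jQ; apply: subset_trans UA; exact: (bigcup_sup j).
have V0 : vpick V != 0.
  by rewrite vpick0 -dimv_eq0; rewrite cardA in dimV; lia.
have vV := memv_pick V.
have := leq_min_dist dC (subvP VC _ vV) V0.
have := subset_leq_card (wsupp_subC (VA _ vV)).
have := cardsC A; rewrite card_ord cardA.
move: (#|~: A|) (#|wsupp _|); lia.
Qed.

(* Every coordinate outside A is a zero of one of the q + 1 words
   v and u + a v, which have at most #|~: A| - d zeros each outside A. *)
Lemma two_dim_bound (F : finFieldType) (n d : nat) (C V : {vspace 'rV[F]_n})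
    (A : {set 'I_n}) :
  has_min_dist C d -> (V <= C)%VS -> (2 <= \dim V)%N ->
  (forall x, x \in V -> forall i, i \in A -> x 0 i = 0) ->
  (#|~: A| <= (#|F|.+1) * (#|~: A| - d))%N.
Proof.
move=> dC VC V2 VA.
have v0 : vpick V != 0 by rewrite vpick0 -dimv_eq0; lia.
have vV := memv_pick V; set v := vpick V in v0 vV.
have /subvPn[u uV uv] : ~~ (V <= <[v]>)%VS.
  by apply/negP=> /dimvS; rewrite dim_vline v0; lia.
pose z (o : option F) := if o is Some a then u + a *: v else v.
have zV o : z o \in V by case: o => [a|] //=; rewrite memvD ?memvZ.
have z0 o : z o != 0.
  case: o => [a|] //=; apply: contra uv; rewrite addr_eq0 => /eqP ->.
  by rewrite -scaleNr memvZ ?memv_line.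
have zd o : (#|~: A :\: wsupp (z o)| <= #|~: A| - d)%N.
  have := leq_min_dist dC (subvP VC _ (zV o)) (z0 o).
  rewrite -(cardsID (wsupp (z o)) (~: A)) (setIidPr (wsupp_subC (VA _ (zV o)))).
  by lia.
have : ~: A \subset \bigcup_(o : option F) (~: A :\: wsupp (z o)).
  apply/subsetP=> i iA; apply/bigcupP.
  have [vi|vi] := eqVneq (v 0 i) 0.
    by exists None => //; rewrite in_setD iA inE /= vi eqxx.
  exists (Some (- (u 0 i / v 0 i))) => //; rewrite in_setD iA inE /= !mxE.
  by rewrite mulNr divfK // subrr eqxx.
move=> /subset_leq_card /leq_trans; apply.
apply: (@leq_trans (\sum_(o : option F) #|~: A :\: wsupp (z o)|)).
  exact: leq_card_bigcup.
apply: (@leq_trans (\sum_(o : option F) (#|~: A| - d))).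
  by apply: leq_sum => o _; exact: zd.
by rewrite sum_nat_const card_option.
Qed.

(** The supports of [b] checks cover at most [b * (r + 1)] coordinates, so they can be padded to
    exactly [\dim C - 2 + b]; shortening there leaves at least two dimensions for
    [two_dim_bound]. *)
Lemma plotkin_shortened (F : finFieldType) (n d r l : nat) (C : {vspace 'rV[F]_n})
    (y : nat -> 'rV[F]_n) (p : nat -> 'I_n) (b : nat) :
  local_checks C r l y p -> has_min_dist C d ->
  (b <= l)%N -> (b * r + 2 <= \dim C)%N -> (\dim C + b <= n.+2)%N ->
  (n.+2 - (\dim C + b) <= #|F|.+1 * (n.+2 - (\dim C + b) - d))%N.
Proof.
move=> H dC bl brk kbn.
have [|Q Qb] := @exists_subset_card 'I_l b; first by rewrite card_ord.
have Ub : (#|\bigcup_(j in Q) wsupp (y j)| <= b * r.+1)%N.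
  rewrite -Qb -sum_nat_const.
  apply: leq_trans (leq_card_bigcup _ _) _.
  by apply: leq_sum => j _; exact: (lc_weight H).
have [|A [UA cardA]] := @exists_superset_card _
    (\bigcup_(j in Q) wsupp (y j)) (\dim C - 2 + b).
  by rewrite card_ord; move: Ub; rewrite mulnS; lia.
have [|V [VC VA dimV]] := @shortened_subcode _ _ _ _ _ _ _ Q A H.
  by move=> j jQ; apply: subset_trans UA; exact: (bigcup_sup j).
have -> : (n.+2 - (\dim C + b))%N = #|~: A|.
  by have := cardsC A; rewrite card_ord cardA; lia.
apply: two_dim_bound dC VC _ VA.
by rewrite cardA Qb in dimV; lia.
Qed.

(** * Waste of the repair groups *)

Lemma card_sum_mem (T : finType) (A : {set T}) : #|A| = (\sum_x (x \in A))%N.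
Proof. by rewrite -sum1_card big_mkcond; apply: eq_bigr => x _; case: (x \in A). Qed.

(* A point lying in exactly one of the sets is lost when that set is removed,
   the other points of the union never are. *)
Lemma sum_card_bigcup_D1 (I T : finType) (S : I -> {set T}) (Q : {set I}) :
  (2 <= #|Q|)%N ->
  (\sum_(i in Q) #|\bigcup_(j in Q :\ i) S j| <=
     \sum_(i in Q) #|S i| + (#|Q| - 2) * #|\bigcup_(j in Q) S j|)%N.
Proof.
move=> Q2; under eq_bigr do rewrite card_sum_mem.
under [X in (_ <= X + _)%N]eq_bigr do rewrite card_sum_mem.
rewrite (card_sum_mem (\bigcup_(j in Q) S j)) big_distrr /=.
rewrite exchange_big [X in (_ <= X + _)%N]exchange_big -big_split /=.
apply: leq_sum => x _.
have cardQ (P : pred I) : (\sum_(i in Q) P i = #|[set i in Q | P i]|)%N.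
  rewrite -sum1_card big_mkcond [RHS]big_mkcond; apply: eq_bigr => i _.
  by rewrite inE; case: (i \in Q) => //=; case: (P i).
rewrite (cardQ (fun i => x \in S i)).
set M := [set i in Q | x \in S i].
case: (set_0Vmem M) => [M0|[a aM]].
  rewrite big1 // => i iQ; case: bigcupP => // -[j]; rewrite !inE => /andP[_ jQ] xj.
  by have := in_set0 j; rewrite -M0 inE jQ xj.
have [aQ xa] : a \in Q /\ x \in S a by move: aM; rewrite inE => /andP.
have -> : x \in \bigcup_(j in Q) S j by apply/bigcupP; exists a.
(* With two sets through [x], the left side is at most [#|Q|], and so at most [2 + (#|Q| - 2)]. With
   a single one, [S a], the term [i = a] is lost and [#|Q| - 1] remains. *)
rewrite muln1; have [M2|] := leqP 2 #|M|.
  apply: (@leq_trans #|Q|); last by lia.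
  by rewrite -sum1_card; apply: leq_sum => i _; case: (_ \in _).
move=> M1; have {M1}M1 : #|M| = 1%N by move: M1; rewrite (cardD1 a M) aM; lia.
rewrite (bigD1 a) //= [X in (nat_of_bool X + _)%N](_ : _ = false); last first.
  apply/bigcupP => -[j]; rewrite !inE => /andP[ja jQ] xj.
  have /eqP/cards1P[b Mb] := M1.
  have : j \in M by rewrite inE jQ.
  by move: aM ja; rewrite Mb !inE => /eqP-> /negPf->.
apply: (@leq_trans (\sum_(i in Q | i != a) 1)).
  by apply: leq_sum => i _; case: (_ \in _).
by have := cardsD1 a Q; rewrite -sum1dep_card aQ -sum1_card (bigD1 a) //=; lia.
Qed.

(** This measures how far the sets are from being disjoint of full size [R]. The subtraction does
    not truncate as long as every set has at most [R] elements. *)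
Definition waste (I T : finType) (S : I -> {set T}) (R : nat) (Q : {set I}) : nat :=
  (#|Q| * R - #|\bigcup_(j in Q) S j|)%N.

Lemma waste_bigcup (I T : finType) (S : I -> {set T}) (R : nat) (Q : {set I}) :
  (forall j, #|S j| <= R)%N ->
  (waste S R Q + #|\bigcup_(j in Q) S j| = #|Q| * R)%N.
Proof.
move=> SR; rewrite subnK // (leq_trans (leq_card_bigcup _ _)) //.
by rewrite -sum_nat_const leq_sum.
Qed.

(** Averaging: by [sum_card_bigcup_D1], the wastes of the families [Q :\ i] add up to at least
    [(#|Q| - 2) * waste S R Q]. *)
Lemma waste_D1 (I T : finType) (S : I -> {set T}) (R : nat) (Q : {set I}) :
  (forall j, #|S j| <= R)%N -> (2 <= #|Q|)%N ->
  exists2 i, i \in Q & ((#|Q| - 2) * waste S R Q <= #|Q| * waste S R (Q :\ i))%N.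
Proof.
move=> SR Q2; apply/exists_inP; apply: contraT.
rewrite negb_exists_in => /forall_inP Hlt.
(* The [+ 1] keeps the strictness of the negated inequality through the summation. *)
have : (\sum_(i in Q) (#|Q| * waste S R (Q :\ i) + 1) <=
        \sum_(i in Q) (#|Q| - 2) * waste S R Q)%N.
  by apply: leq_sum => i /Hlt; lia.
rewrite big_split /= -big_distrr sum1_card sum_nat_const /=.
have : (\sum_(i in Q) waste S R (Q :\ i) +
        \sum_(i in Q) #|\bigcup_(j in Q :\ i) S j| = #|Q| * ((#|Q| - 1) * R))%N.
  rewrite -big_split -sum_nat_const; apply: eq_bigr => i iQ /=.
  by rewrite waste_bigcup // (cardsD1 i Q) iQ; congr (_ * _)%N; lia.
have := sum_card_bigcup_D1 S Q2.
have : (\sum_(i in Q) #|S i| <= #|Q| * R)%N by rewrite -sum_nat_const leq_sum.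
have := waste_bigcup Q SR.
move: (waste S R Q) (#|\bigcup_(j in Q) S j|) (\sum_(i in Q) waste _ _ _)%N
  (\sum_(i in Q) #|\bigcup_(j in Q :\ i) _|)%N (\sum_(i in Q) #|S i|)%N => w u sw su ss.
case: #|Q| Q2 => [|[|q]] // _ h1 h2 h3 h4.
rewrite !subSS !subn0 in h3 h4 * => h5.
have e : (q * (w + u) = q * (q.+2 * R))%N by rewrite h1.
have : (q * w <= sw)%N by nia.
by rewrite -(leq_pmul2l (ltn0Sn q.+1)); lia.
Qed.

(** Removing sets one at a time by [waste_D1], the factors [(j - 2) / j] for [j] from [#|Q|] down to
    [h + 1] telescope to [h (h - 1) / (#|Q| (#|Q| - 1))]. *)
Lemma waste_subset (I T : finType) (S : I -> {set T}) (R h : nat) (Q : {set I}) :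
  (forall j, #|S j| <= R)%N -> (2 <= h)%N -> (h <= #|Q|)%N ->
  exists Q' : {set I}, #|Q'| = h /\
    (waste S R Q * (h * h.-1) <= waste S R Q' * (#|Q| * #|Q|.-1))%N.
Proof.
move=> SR h2; move: {2}(#|Q| - h)%N (erefl (#|Q| - h)%N) => m.
elim: m h h2 => [|m IHm] h h2 hm hQ.
  have hQ' : #|Q| = h by lia.
  by exists Q; rewrite hQ'.
have [||| Q' [Q'h wQ']] := IHm h.+1; [lia|lia|lia|].
have [|i iQ' wi] := @waste_D1 _ _ S R Q' SR; first by rewrite Q'h; lia.
exists (Q' :\ i); split; first by have := cardsD1 i Q'; rewrite iQ' Q'h; lia.
rewrite Q'h in wi; rewrite /= in wQ'.
case: h {IHm} h2 hm hQ Q'h wQ' wi => [|[|h]] // _ _ _ _ wQ' wi.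
rewrite /= subSS subn1 /= in wi wQ' *.
rewrite -(leq_pmul2l (ltn0Sn h.+2)).
have := leq_mul wQ' (leqnn h.+1); have := leq_mul wi (leqnn (#|Q| * #|Q|.-1)).
by nia.
Qed.

(** * The Hamming bound *)

Lemma dotrD (F : finFieldType) (n : nat) (y x z : 'rV[F]_n) :
  dotr y (x + z) = dotr y x + dotr y z.
Proof. by rewrite -big_split; apply: eq_bigr => i _; rewrite mxE mulrDr. Qed.

Lemma dotrZ (F : finFieldType) (n : nat) (y x : 'rV[F]_n) a :
  dotr y (a *: x) = a * dotr y x.
Proof. by rewrite mulr_sumr; apply: eq_bigr => i _; rewrite mxE mulrCA. Qed.

Lemma dotr_sum (F : finFieldType) (n : nat) (I : finType) (P : pred I)
    (y : 'rV[F]_n) (x : I -> 'rV[F]_n) :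
  dotr y (\sum_(i | P i) x i) = \sum_(i | P i) dotr y (x i).
Proof.
apply: (big_morph (dotr y)) => [u v|]; first exact: dotrD.
by rewrite /dotr big1 // => i _; rewrite mxE mulr0.
Qed.

Lemma dotr_delta (F : finFieldType) (n : nat) (y : 'rV[F]_n) i :
  dotr y (delta_mx 0 i) = y 0 i.
Proof.
rewrite /dotr (bigD1 i) //= big1 => [|j ji]; first by rewrite mxE !eqxx mulr1 addr0.
by rewrite mxE (negPf ji) andbF mulr0.
Qed.

(** A word of the kernel that vanishes off the [l] pivots vanishes everywhere, so the kernel has
    dimension at most [n - l]. *)
Lemma card_checks_kernel (F : finFieldType) (n r l : nat) (C : {vspace 'rV[F]_n})
    (y : nat -> 'rV[F]_n) (p : nat -> 'I_n) :
  local_checks C r l y p ->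
  exists D : {vspace 'rV[F]_n},
    (\dim D + l <= n)%N /\
    forall x, x \in D <-> (forall j : 'I_l, dotr (y j) x = 0).
Proof.
move=> H; pose M : 'M[F]_(n, l) := \matrix_(i, j) y j 0 i.
pose f : 'Hom('rV[F]_n, 'rV[F]_l) := linfun (mulmxr M).
have fE x j : f x 0 j = dotr (y j) x.
  by rewrite lfunE /= mxE; apply: eq_bigr => i _; rewrite mxE mulrC.
have Dx x : reflect (forall j : 'I_l, dotr (y j) x = 0) (x \in lker f).
  rewrite memv_ker; apply: (iffP eqP) => [/rowP fx j|fx].
    by rewrite -fE fx mxE.
  by apply/rowP => j; rewrite fE fx mxE.
exists (lker f); split; last by move=> x; split=> /Dx.
pose P := [set p (val j) | j : 'I_l].
have Pl : #|P| = l by rewrite card_imset ?card_ord //; exact: (pivot_inj H).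
have [V [VD VP dimV]] := vanishing_subcode (lker f) (~: P).
have V0 : V = 0%VS.
  apply/eqP; rewrite -subv0; apply/subvP=> x xV; rewrite memv0; apply/eqP/rowP=> i.
  rewrite mxE; apply: (pivots_vanish (Q := xpredT) (A := setT) H) => // [j _|h _ hP].
    exact/(Dx x)/(subvP VD).
  apply: VP => //; rewrite inE; apply/imsetP=> -[j _ hj].
  by have := hP j isT; rewrite hj eqxx.
have PC : (l + #|~: P| = n)%N by rewrite -{1}Pl cardsC card_ord.
by apply: leq_trans (leq_add dimV (leqnn l)) _; rewrite V0 dimv0 add0n addnC PC.
Qed.

(* On the coordinates met by a single check, a weight two vector orthogonal to
   all checks is obtained by cancelling against a base point of that check. *)
Lemma weight_two_family (F : finFieldType) (n r l : nat) (C : {vspace 'rV[F]_n})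
    (y : nat -> 'rV[F]_n) (p : nat -> 'I_n) :
  local_checks C r l y p ->
  (forall i, exists2 j, (j < l)%N & i \in wsupp (y j)) ->
  exists (J : {set 'I_n}) (w : 'I_n -> 'rV[F]_n),
    [/\ forall i (j : 'I_l), i \in J -> dotr (y j) (w i) = 0,
        forall i h, i \in J -> h \in J -> w i 0 h = (h == i)%:R,
        forall i, (#|wsupp (w i)| <= 2)%N &
        (2 * n <= #|J| + l * r.+2)%N].
Proof.
move=> H cov.
have /fin_all_exists[o oP] (i : 'I_n) : exists j : 'I_l, i \in wsupp (y j).
  by have [j jl iy] := cov i; exists (Ordinal jl).
pose sgl := [set i | [forall j : 'I_l, (i \in wsupp (y j)) ==> (j == o i)]].
(* The choice depends on [i] only through [o i], so the singly covered coordinates of one check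
   share their base point. For [i] in [sgl] the default is never reached. *)
pose base (i : 'I_n) := odflt i [pick h in sgl | o h == o i].
have baseP i : i \in sgl -> base i \in sgl /\ o (base i) = o i.
  move=> iS; rewrite /base; case: pickP => [h /andP[hS /eqP]//|].
  by move/(_ i); rewrite iS eqxx.
have base_eq i h : i \in sgl -> o i = o h -> base i = base h.
  move=> iS oih; rewrite /base (eq_pick (Q := [pred z in sgl | o z == o h])).
    by case: pickP => // /(_ i) /=; rewrite iS oih eqxx.
  by move=> z /=; rewrite oih.
pose J := [set i in sgl | base i != i].
pose w i := delta_mx 0 i -
  (y (o i) 0 i / y (o i) 0 (base i)) *: delta_mx 0 (base i) : 'rV[F]_n.
have wE i h : w i 0 h = (h == i)%:R -
    (y (o i) 0 i / y (o i) 0 (base i)) * (h == base i)%:R by rewrite !mxE.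
have sgl0 i (j : 'I_l) : i \in sgl -> j != o i -> y j 0 i = 0.
  rewrite inE => /forallP/(_ j); case: (boolP (_ \in _)) => [_ /eqP->|/wsuppPn//].
  by rewrite eqxx.
exists J, w; split.
- move=> i j /setIdP[iS _]; have [bS ob] := baseP i iS.
  rewrite dotrD -scaleNr dotrZ !dotr_delta mulNr.
  have [->|jo] := eqVneq j (o i); last first.
    by rewrite (sgl0 i j) // (sgl0 (base i) j) ?ob // mulr0 subr0.
  rewrite divfK ?subrr //.
  by have := oP (base i); rewrite ob inE.
- move=> i h /setIdP[iS bi] /setIdP[hS bh]; rewrite wE.
  case: (eqVneq h (base i)) => [e|_]; last by rewrite mulr0n mulr0 subr0.
  have [_ ob] := baseP i iS.
  by move: bh; rewrite (base_eq h i hS) -?e ?eqxx // e.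
- move=> i; apply: (@leq_trans #|[set i; base i]|); last by rewrite cards2; case: eqP.
  apply/subset_leq_card/subsetP=> h; rewrite !inE wE.
  by case: (h == i) => //=; case: (h == base i) => //=; rewrite mulr0 subr0 eqxx.
(* Only base points are lost from [sgl] to [J], at most one for each check. *)
have sglJ : (#|sgl| <= #|J| + l)%N.
  rewrite -(cardsID J sgl) leq_add ?subset_leq_card ?subsetIr //.
  have inj : {in sgl :\: J &, injective o}.
    move=> i h /setDP[iS iJ] /setDP[hS hJ] oih.
    move: iJ hJ; rewrite [i \in J]inE [h \in J]inE.
    by rewrite iS hS /= !negbK => /eqP<- /eqP<-; apply: base_eq.
  by rewrite -(card_in_imset inj) (leq_trans (max_card _)) // card_ord.
(* Double counting: every coordinate lies in at least two supports, except those of [sgl], which lie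
   in one. *)
have : (2 * n <= \sum_(j < l) #|wsupp (y j)| + #|sgl|)%N.
  under eq_bigr do rewrite card_sum_mem.
  rewrite exchange_big /= (card_sum_mem sgl) -big_split /=.
  have -> : (2 * n = \sum_(i < n) 2)%N by rewrite sum_nat_const card_ord mulnC.
  apply: leq_sum => i _; rewrite (bigD1 (o i)) //= oP.
  case: (boolP (i \in sgl)) => [_|]; first by rewrite addn1 !ltnS leq_addr.
  rewrite inE negb_forall => /existsP[j]; rewrite negb_imply => /andP[ij jo].
  by rewrite (bigD1 j) //= ij; lia.
have : (\sum_(j < l) #|wsupp (y j)| <= l * r.+1)%N.
  apply: (@leq_trans (\sum_(j < l) r.+1)); last by rewrite sum_nat_const card_ord.
  by apply: leq_sum => j _; exact: (lc_weight H).
rewrite !mulnS; lia.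
Qed.

Definition fsupp (F : finFieldType) (T : finType) (f : {ffun T -> F}) : {set T} :=
  [set i | f i != 0].

(** Once [S = fsupp f :&: J0] is fixed, the values are chosen independently: nonzero on [S],
    arbitrary on [J1], zero elsewhere. *)
Lemma card_errors (F : finFieldType) (T : finType) (J0 J1 : {set T}) (e : nat) :
  [disjoint J0 & J1] ->
  #|[set f : {ffun T -> F} | (fsupp f \subset J0 :|: J1)
                             && (#|fsupp f :&: J0| == e)]|
    = ('C(#|J0|, e) * #|F|.-1 ^ e * #|F| ^ #|J1|)%N.
Proof.
move=> dJ; pose dr := [set S : {set T} | S \subset J0 & #|S| == e].
rewrite -sum1_card (partition_big (fun f => fsupp f :&: J0) (mem dr)) /=; last first.
  by move=> f; rewrite !inE => /andP[_ ->]; rewrite subsetIr.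
rewrite -(cards_draws J0 e) -/dr -mulnA -sum_nat_const.
apply: eq_bigr => S; rewrite inE => /andP[SJ0 /eqP Se].
pose G (i : T) : pred F := if i \in S then predC1 0 else if i \in J1 then predT else pred1 0.
transitivity #|(family G : simpl_pred {ffun T -> F})|.
  rewrite -sum1_card; apply: eq_bigl => f; rewrite !inE.
  apply/andP/familyP.
    move=> [/andP[/subsetP fJ _] /eqP fS] i; rewrite /G.
    case: (boolP (i \in S)) => [|iS]; first by rewrite -fS !inE => /andP[].
    case: (boolP (i \in J1)) => // iJ1; rewrite !inE; apply: contraT => fi.
    have : i \in J0 :|: J1 by apply: fJ; rewrite inE.
    by rewrite inE (negPf iJ1) orbF => iJ0; move: iS; rewrite -fS !inE fi iJ0.
  move=> fG; have fSE : fsupp f :&: J0 = S.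
    apply/setP=> i; have := fG i; rewrite /G !inE.
    case: (boolP (i \in S)) => [iS|iS]; first by rewrite inE => ->; exact: (subsetP SJ0).
    case: (boolP (i \in J1)) => [iJ1 _|_]; last by rewrite inE => /eqP->; rewrite eqxx.
    by rewrite (disjointFl dJ iJ1) andbF.
  rewrite fSE Se !eqxx; split=> //; rewrite andbT.
  apply/subsetP=> i; have := fG i; rewrite /G !inE.
  case: (boolP (i \in S)) => [iS _ _|_]; first by rewrite (subsetP SJ0).
  by case: (boolP (i \in J1)) => [|_]; rewrite ?orbT // inE => /eqP->; rewrite eqxx.
rewrite card_family foldrE big_map big_enum /=.
rewrite (bigID (mem S)) /=; congr (_ * _)%N.
  rewrite (eq_bigr (fun=> #|F|.-1)) => [|i iS]; first by rewrite prod_nat_const Se.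
  by rewrite /G iS cardC1.
rewrite (bigID (mem J1)) /= [X in (_ * X)%N]big1 ?muln1.
  rewrite (eq_bigr (fun=> #|F|)) => [|i /andP[/negPf iS iJ1]]; last by rewrite /G iS iJ1.
  rewrite prod_nat_const; congr (_ ^ _)%N; apply: eq_card => i; rewrite [LHS]unfold_in.
  case: (boolP (i \in J1)) => iJ1; rewrite ?andbF ?andbT //; apply/negP => iS.
  by have := disjointFl dJ iJ1; rewrite (subsetP SJ0).
by move=> i /andP[/negPf iS /negPf iJ1]; rewrite /G iS iJ1 card1.
Qed.

(* Packing the translates of C by the combinations of the w i whose coefficients
   are nonzero at e indices outside a fixed b-subset of J and arbitrary on it;
   b = 1 replaces puncturing when the minimum distance is even. *)
Lemma hamming_bound (F : finFieldType) (n d r l : nat) (C : {vspace 'rV[F]_n})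
    (y : nat -> 'rV[F]_n) (p : nat -> 'I_n) (J : {set 'I_n}) (w : 'I_n -> 'rV[F]_n)
    (e b : nat) :
  local_checks C r l y p -> has_min_dist C d ->
  (forall i (j : 'I_l), i \in J -> dotr (y j) (w i) = 0) ->
  (forall i h, i \in J -> h \in J -> w i 0 h = (h == i)%:R) ->
  (forall i, (#|wsupp (w i)| <= 2)%N) ->
  (2 * (2 * e + b) < d)%N -> (b <= #|J|)%N ->
  ('C(#|J| - b, e) * #|F|.-1 ^ e * #|F| ^ b <= #|F| ^ (n - \dim C - l))%N.
Proof.
move=> H dC wD wJ w2 ebd bJ.
have [D [dimD Dx]] := card_checks_kernel H.
have CD : (C <= D)%VS.
  by apply/subvP=> c cC; apply/Dx => j; apply: (lc_orth H).
have kl : (\dim C + l <= n)%N by have := dimvS CD; lia.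
have [J1 J1b J1J] : exists2 J1 : {set 'I_n}, #|J1| = b & J1 \subset J.
  have [|A Ab] := @exists_subset_card {i | i \in J} b; first by rewrite card_sig.
  exists [set val i | i in A]; first by rewrite card_imset //; exact: val_inj.
  by apply/subsetP=> _ /imsetP[i _ ->]; exact: (valP i).
pose J0 := J :\: J1.
have J0b : #|J0| = (#|J| - b)%N.
  by have := cardsID J1 J; rewrite (setIidPr J1J) J1b -/J0; lia.
have dJ : [disjoint J0 & J1].
  by rewrite disjoint_sym disjoints_subset; apply/subsetP=> i; rewrite !inE => ->.
have J01 : J0 :|: J1 = J.
  apply/setP=> i; rewrite !inE.
  by case: (boolP (i \in J1)) => [/(subsetP J1J)->|_]; rewrite ?orbF.
pose E := [set f : {ffun 'I_n -> F} | (fsupp f \subset J0 :|: J1)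
                             && (#|fsupp f :&: J0| == e)].
pose phi (f : {ffun 'I_n -> F}) := \sum_(i in J) f i *: w i.
have phiJ f i : i \in J -> phi f 0 i = f i.
  move=> iJ; rewrite /phi summxE (bigD1 i) //= big1 => [|h /andP[hJ hi]].
    by rewrite mxE wJ // eqxx mulr1 addr0.
  by rewrite mxE wJ // eq_sym (negPf hi) mulr0.
have phiD f : phi f \in D.
  apply/Dx => j; rewrite dotr_sum big1 // => i iJ.
  by rewrite dotrZ wD ?mulr0.
(* Two patterns differ in at most [2 * e + b] indices, and each index contributes a multiple of some
   [w i], of weight at most two. *)
have phi_wt f g : f \in E -> g \in E -> (#|wsupp (phi f - phi g)| < d)%N.
  rewrite !inE J01 => /andP[fJ /eqP fe] /andP[gJ /eqP ge].
  apply: leq_ltn_trans ebd.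
  pose S := [set i in J | f i != g i].
  apply: (@leq_trans (\sum_(i in S) #|wsupp (w i)|)).
    apply: leq_trans (leq_card_bigcup _ _); apply/subset_leq_card/subsetP=> h.
    rewrite inE -sumrB summxE => nz; apply/bigcupP; apply/exists_inP; apply: contraNT nz.
    rewrite negb_exists_in => /forall_inP Sh; rewrite big1 // => i iJ.
    rewrite -scalerBl mxE; have [->|fg] := eqVneq (f i) (g i); first by rewrite subrr mul0r.
    by rewrite (wsuppPn (Sh i _)) ?mulr0 // inE iJ.
  apply: (@leq_trans (\sum_(i in S) 2)); first by apply: leq_sum.
  rewrite sum_nat_const mulnC leq_mul2l /=.
  apply: (@leq_trans #|(fsupp f :&: J0) :|: (fsupp g :&: J0) :|: J1|).
    apply/subset_leq_card/subsetP=> i; rewrite !inE => /andP[iJ fg].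
    case: (boolP (i \in J1)) => iJ1; rewrite ?orbT // iJ /= !andbT orbF.
    have [f0|_] := eqVneq (f i) 0 => //=.
    have [g0|_] := eqVneq (g i) 0 => //=.
    by rewrite f0 g0 eqxx in fg.
  rewrite (leq_trans (leq_card_setU _ _)) // J1b leq_add2r.
  by rewrite (leq_trans (leq_card_setU _ _)) // fe ge; lia.
(* A collision makes [phi f - phi g] a codeword of weight below [d], hence zero; its coordinates on
   [J] then identify [f] with [g]. *)
have inj : {in setX [set c in C] E &, injective (fun cf => cf.1 + phi cf.2)}.
  move=> [c f] [c' g]; rewrite !inE /= -!/(_ \in E) => /andP[cC fE] /andP[cC' gE] eq.
  have fE' : f \in E by rewrite inE. have gE' : g \in E by rewrite inE.
  have cc : c' - c = phi f - phi g.
    by apply/eqP; rewrite subr_eq addrAC eq_sym subr_eq addrC eq addrC.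
  have cc0 : c' - c = 0.
    apply/eqP; apply: contraT => nz.
    have := leq_min_dist dC (memvB cC' cC) nz.
    by rewrite cc leqNgt phi_wt.
  congr (_, _); first by apply/eqP; rewrite eq_sym -subr_eq0 cc0.
  apply/ffunP=> i; case: (boolP (i \in J)) => iJ.
    have /rowP/(_ i) : phi f - phi g = 0 by rewrite -cc.
    by rewrite [LHS]mxE [in X in _ + X]mxE [RHS]mxE !phiJ // => /subr0_eq.
  have out h : h \in E -> h i = 0.
    rewrite inE J01 => /andP[/subsetP hJ _]; apply: contraNeq iJ => hi.
    by apply: hJ; rewrite inE.
  by rewrite !out.
have : (#|C| * #|E| <= #|D|)%N.
  rewrite -[#|C|]cardsE -cardsX -(card_in_imset inj) subset_leq_card //.
  apply/subsetP=> x /imsetP[[c f]]; rewrite !inE /= => /andP[cC _] ->.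
  by rewrite memvD // (subvP CD).
rewrite !card_vspace card_errors // J0b J1b => cED.
have q0 : (0 < #|F|)%N by apply/card_gt0P; exists 0.
rewrite -(leq_pmul2l (_ : 0 < #|F| ^ \dim C)%N) ?expn_gt0 ?q0 //.
apply: leq_trans cED _; rewrite -expnD leq_pexp2l //.
by move: (\dim D) (\dim C) dimD kl => s t; lia.
Qed.

(** * Singleton-optimal codes *)

(* Here h = ceil (k / r) and epsilon = 1 - u / r. *)
Lemma opt_lrc_params (c : opt_lrc) :
  exists h u, [/\ (lrc_k c + u = h * lrc_r c)%N, (rem1 (lrc_k c) (lrc_r c) + u = lrc_r c)%N,
    (u < lrc_r c)%N, (lrc_n c + 2 = lrc_d c + lrc_k c + h)%N & (2 <= h)%N].
Proof.
case: c => F n k d r C [/= r1 _ _ _] opt rk _ d3.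
pose h := (k %/ r + ~~ (r %| k))%N; pose u := (h * r - k)%N.
have kE := divn_eq k r; have kr : (k %% r < r)%N by rewrite ltn_pmod.
have [kuE ru ur] : [/\ k + u = h * r, rem1 k r + u = r & u < r]%N.
  rewrite /u /h /rem1 /dvdn; case: eqP => k0 /=; rewrite ?addn0 ?addn1 ?mulSn.
    by split; lia.
  by split; lia.
have h2 : (2 <= h)%N by rewrite ltnNge; apply/negP; nia.
exists h, u; split=> //.
have hc : Num.ceil (k%:R / r%:R : rat) = h%:Z.
  apply: ceil_def; have r0 : 0 < r%:R :> rat by rewrite ltr0n.
  rewrite ltr_pdivlMr // ler_pdivrMr // intrB -!pmulrn.
  have e : (k%:R + u%:R = h%:R * r%:R :> rat) by rewrite -natrM -natrD kuE.
  have u0 : 0 <= u%:R :> rat by rewrite ler0n.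
  have ur' : u%:R < r%:R :> rat by rewrite ltr_nat.
  apply/andP; split; nra.
by move: opt; rewrite /singleton_optimal hc; lia.
Qed.

Lemma leq_covered (F : finFieldType) (n r l : nat) (C : {vspace 'rV[F]_n})
    (y : nat -> 'rV[F]_n) (p : nat -> 'I_n) :
  local_checks C r l y p ->
  (forall i, exists2 j, (j < l)%N & i \in wsupp (y j)) ->
  \bigcup_(j in [set: 'I_l]) wsupp (y j) = setT /\ (n <= l * r.+1)%N.
Proof.
move=> H cov.
have covT : \bigcup_(j in [set: 'I_l]) wsupp (y j) = setT.
  apply/setP=> i; rewrite [RHS]inE; apply/bigcupP.
  by have [j jl iy] := cov i; exists (Ordinal jl).
split=> //; have := leq_card_bigcup (mem [set: 'I_l]) (fun j : 'I_l => wsupp (y j)).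
rewrite covT cardsT card_ord => /leq_trans; apply.
apply: (@leq_trans (\sum_(j in [set: 'I_l]) r.+1)).
  by apply: leq_sum => j _; exact: (lc_weight H).
by rewrite sum_nat_const cardsT card_ord.
Qed.

Lemma leq_dim_checks (F : finFieldType) (n r l : nat) (C : {vspace 'rV[F]_n})
    (y : nat -> 'rV[F]_n) (p : nat -> 'I_n) :
  local_checks C r l y p -> (\dim C + l <= n)%N.
Proof.
move=> H; have [D [dimD Dx]] := card_checks_kernel H.
apply: leq_trans dimD; rewrite leq_add2r dimvS //.
by apply/subvP=> c cC; apply/Dx => j; apply: (lc_orth H).
Qed.

(** If [l < h], then [n <= (h - 1) * (r + 1) < k + h - 1], as [(h - 1) * r < k]; but
    [n = k + h + d - 2]. Hence [h <= l]. *)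
Lemma opt_lrc_checks (c : opt_lrc) h u :
  (lrc_k c + u = h * lrc_r c)%N -> (u < lrc_r c)%N ->
  (lrc_n c + 2 = lrc_d c + lrc_k c + h)%N ->
  exists l y p, [/\ local_checks (lrc_code c) (lrc_r c) l y p,
    forall i, exists2 j, (j < l)%N & i \in wsupp (y j),
    (h <= l)%N, (lrc_n c <= l * (lrc_r c).+1)%N & (lrc_k c + l <= lrc_n c)%N].
Proof.
case: c => F n k d r C [/= r1 kC dC locC] opt rk nr d3 ku ur nE.
have n0 : (0 < n)%N by lia.
have [l [y [p [H cov]]]] := exists_covering_checks n0 locC.
have [_ nl] := leq_covered H cov.
exists l, y, p; split=> //; last by rewrite -kC; apply: leq_dim_checks H.
by rewrite leqNgt; apply/negP; nia.
Qed.

(** Shortening at [h - 2] checks leaves length [d + 2] and two dimensions whatever the residue of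
    [k], so [d + 2 <= 2 * (q + 1)]. *)
Lemma opt_lrc_d_le_2q (c : opt_lrc) : (lrc_d c <= 2 * lrc_q c)%N.
Proof.
have [h [u [ku _ ur nE h2]]] := opt_lrc_params c.
have [l [y [p [H _ hl _ _]]]] := opt_lrc_checks ku ur nE.
have [r1 kC dC _] := lrc_axiom c.
have hr : (h * lrc_r c = (h - 2) * lrc_r c + 2 * lrc_r c)%N by rewrite -mulnDl subnK.
have := @plotkin_shortened _ _ _ _ _ _ _ _ (h - 2) H dC.
rewrite kC -/(lrc_q c).
have -> : ((lrc_n c).+2 - (lrc_k c + (h - 2)) = lrc_d c + 2)%N by lia.
have -> : (lrc_d c + 2 - lrc_d c = 2)%N by lia.
move=> plotkin; have := plotkin _ _ _; lia.
Qed.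

(** Here [k - (h - 1) * r] is the remainder, at least 2, so one more check can be used: length
    [d + 1] remains and [d + 1 <= q + 1]. *)
Lemma opt_lrc_d_le_q (c : opt_lrc) :
  (2 <= rem1 (lrc_k c) (lrc_r c))%N -> (lrc_d c <= lrc_q c)%N.
Proof.
move=> s2; have [h [u [ku su ur nE h2]]] := opt_lrc_params c.
have [l [y [p [H _ hl _ _]]]] := opt_lrc_checks ku ur nE.
have [r1 kC dC _] := lrc_axiom c.
have hr : (h * lrc_r c = (h - 1) * lrc_r c + lrc_r c)%N.
  by rewrite -mulSnr -subSn ?subSS ?subn0; lia.
have := @plotkin_shortened _ _ _ _ _ _ _ _ (h - 1) H dC.
rewrite kC -/(lrc_q c).
have -> : ((lrc_n c).+2 - (lrc_k c + (h - 1)) = lrc_d c + 1)%N by lia.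
have -> : (lrc_d c + 1 - lrc_d c = 1)%N by lia.
move=> plotkin; have := plotkin _ _ _; lia.
Qed.

(** Any [h] checks cover at least [k + h] of [h * (r + 1) = k + u + h] places, so they waste at most
    [u]. All [l] checks together waste [l * (r + 1) - n], and [waste_subset] compares the two. *)
Lemma opt_lrc_waste (c : opt_lrc) h u :
  (lrc_k c + u = h * lrc_r c)%N -> (u < lrc_r c)%N -> (2 <= h)%N ->
  (lrc_n c + 2 = lrc_d c + lrc_k c + h)%N ->
  exists l, [/\ (h <= l)%N, (lrc_n c <= l * (lrc_r c).+1)%N, (lrc_k c + l <= lrc_n c)%N &
    ((l * (lrc_r c).+1 - lrc_n c) * (h * h.-1) <= u * (l * l.-1))%N].
Proof.
move=> ku ur h2 nE; have [l [y [p [H cov hl nl kl]]]] := opt_lrc_checks ku ur nE.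
have [r1 kC dC _] := lrc_axiom c; have d3 := lrc_d_ge3 c; have rk := lrc_r_lt_k c.
exists l; split=> //.
have wt (j : 'I_l) : (#|wsupp (y j)| <= (lrc_r c).+1)%N by exact: (lc_weight H).
have [|Q [Qh]] := @waste_subset _ _ (fun j : 'I_l => wsupp (y j)) _ h [set: 'I_l] wt h2.
  by rewrite cardsT card_ord.
have [covT _] := leq_covered H cov.
rewrite {1}/waste covT !cardsT !card_ord => /leq_trans; apply; apply: leq_mul => //.
have := @checks_union_ge _ _ _ _ _ _ _ _ Q H dC.
rewrite kC Qh => union_ge.
have {union_ge} : (lrc_k c + h <= #|\bigcup_(j in Q) wsupp (y j)|)%N by apply: union_ge; lia.
by have := waste_bigcup Q wt; rewrite Qh mulnS; lia.
Qed.

Lemma opt_lrc_small_d (c : opt_lrc) :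
  let n := lrc_n c in let d := lrc_d c in let r := lrc_r c in
  (r + 2 - rem1 (lrc_k c) r < d < r + 2)%N ->
  (n * (r + 2 - d) < (d + r) * ((d - 1) * r - 1))%N.
Proof.
have [h [u [ku su ur nE h2]]] := opt_lrc_params c; move=> /= /andP[hd dr].
have [l [hl nl kl wl]] := opt_lrc_waste ku ur h2 nE.
have d3 := lrc_d_ge3 c.
move: (lrc_n c) (lrc_k c) (lrc_d c) (lrc_r c) (rem1 _ _) ku su ur nE hd dr nl kl wl d3
  => n k d r s ku su ur nE hd dr nl kl wl d3.
have ud : (u + 2 < d)%N by lia.
have {hd su s}nhu : (n + u + 2 = h * r.+1 + d)%N by rewrite mulnS; lia.
have [g lg] : exists g, l = (h + g)%N by exists (l - h)%N; lia.
have gd : (g + 2 <= d)%N by lia.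
have Wg : (l * r.+1 - n + d = g * r.+1 + u + 2)%N by move: nl; rewrite lg mulnDl; lia.
have g1 : (1 <= g)%N by case: g {gd lg} Wg => // Wg; lia.
have [t dE] : exists t, r.+2 = (d + t.+1)%N by exists (r.+1 - d)%N; lia.
(* The total waste is at least [g * (t + 2) + u], and [l (l - 1) = h (h - 1) + g (2 h + g - 1)]; the
   terms [u h (h - 1)] cancel and [g] divides out. *)
have key : (t.+2 * (h * h.-1) <= u * (2 * h + g.-1))%N.
  rewrite -(leq_pmul2l g1).
  have W1 : (g * t.+2 + u <= l * r.+1 - n)%N.
    case: g g1 Wg {lg gd} => // g _ Wg.
    by have : (g * t.+2 <= g * r.+1)%N; [rewrite leq_mul2l; lia|lia].
  have /leq_trans := leq_mul W1 (leqnn (h * h.-1)) => /(_ _ wl).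
  rewrite lg; case: h h2 {ku nE hl nhu lg wl} => // h _; case: g g1 {gd Wg W1} => // g _.
  by rewrite addnS addSn /=; lia.
have -> : (r + 2 - d = t.+1)%N by lia.
have [D dD] : exists D, d = D.+1 by exists d.-1; lia.
have -> : (d - 1 = D)%N by lia.
rewrite dD; have rD : (r = D + t)%N by lia.
have D2 : (2 <= D)%N by lia.
have nB : (n <= h * r.+1 + D - 1)%N by lia.
(* For [h <= D] the bound [nB] is enough. For larger [h], [key] leaves only [t = 0], that is
   [d = r + 1], and then bounds [h]. *)
have [hD|hD] := leqP h D.
  have hr : (h * r.+1 <= D * r.+1)%N by rewrite leq_mul2r hD orbT.
  have Dr : (2 * r <= D * r)%N by rewrite leq_mul2r D2 orbT.
  have [P PE] : exists P, (D * r = P.+1)%N by exists (D * r).-1; lia.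
  have nP : (n * t.+1 <= (P + 2 * D) * t.+1)%N by rewrite leq_mul2r; lia.
  have tP : (2 * D * t.+1 < 2 * D * P)%N by rewrite ltn_mul2l; lia.
  by rewrite PE subn1 rD /=; lia.
have key2 : (t.+2 * h.-1 <= 3 * u)%N.
  rewrite -(@leq_pmul2l h); last by lia.
  have : (u * (2 * h + g.-1) <= u * (3 * h))%N by rewrite leq_mul2l; lia.
  by lia.
(* Together with [key2] and [u + 2 <= D] this gives [(t + 2) * D < 3 * D]. *)
have tD : (t.+2 * D <= t.+2 * h.-1)%N by rewrite leq_mul2l; lia.
have t0 : t = 0%N.
  case: t {dE key Wg} key2 tD {rD} => // t key2 tD.
  by have : (3 * D <= t.+3 * D)%N; [rewrite leq_mul2r|]; lia.
subst t; rewrite addn0 in rD; subst r.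
have : ((2 * h) * D.+1 <= (3 * D - 4) * D.+1)%N by rewrite leq_mul2r; lia.
have [E DE] : exists E, (D = E.+2)%N by exists (D - 2)%N; lia.
rewrite DE in nB *; have -> : (E.+2 * E.+2 - 1 = E * E + 4 * E + 3)%N by lia.
have -> : (3 * E.+2 - 4 = 3 * E + 2)%N by lia.
by lia.
Qed.

(* N vectors of weight two are found, and m = n - k - l checks are not local. *)
Lemma opt_lrc_hamming (c : opt_lrc) :
  let n := lrc_n c in let d := lrc_d c in let r := lrc_r c in let q := lrc_q c in
  exists N m, [/\ (r * n <= r.+1 * N + r * (r + 2) * (d - 1))%N,
    (m + 2 <= d)%N, (r.+1 * m + rem1 (lrc_k c) r <= r * (d - 1))%N &
    forall e b, (2 * (2 * e + b) < d)%N -> (b <= N)%N ->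
      ('C(N - b, e) * q.-1 ^ e * q ^ b <= q ^ m)%N].
Proof.
move=> n d r q; have [h [u [ku su ur nE h2]]] := opt_lrc_params c.
have [l [y [p [H cov hl nl kl]]]] := opt_lrc_checks ku ur nE.
have [J [w [wD wJ w2 nJ]]] := weight_two_family H cov.
have [r1 kC dC _] := lrc_axiom c; have d3 := lrc_d_ge3 c.
have [N NJ] : exists N, N = #|J| by eexists.
rewrite -NJ in nJ; exists N, (n - lrc_k c - l)%N; split; last first.
- by rewrite NJ => e b ebd bJ; have := hamming_bound H dC wD wJ w2 ebd bJ; rewrite kC.
- rewrite /n /d /r; move: (lrc_k c) (lrc_n c) (lrc_d c) (lrc_r c) (rem1 _ _)
    ku su ur nE hl nl kl d3 r1 => k {}n {}d {}r s ku su ur nE hl nl kl d3 r1.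
  have E : (n + u + 2 = h * r.+1 + d)%N by rewrite mulnS; lia.
  have [t tE] : exists t, (n - k - l = t)%N by eexists.
  have nt : (n = k + l + t)%N by lia.
  (* This combines [n <= l * (r + 1)] with [t + l = n - k = h + d - 2]. *)
  have : (t * r.+1 + n * 1 <= (h + (d - 2)) * r.+1)%N.
    by apply: (@leq_trans ((t + l) * r.+1)); [rewrite mulnDl; lia|rewrite leq_mul2r; lia].
  rewrite tE; case: d d3 {nE tE} E => [|[|d]] // _ E; rewrite !subSS !subn0; lia.
- by rewrite -/n -/d in nE d3 *; lia.
- rewrite /n /d /r; move: (lrc_k c) (lrc_n c) (lrc_d c) (lrc_r c) (rem1 _ _)
    ku su ur nE hl nl kl nJ d3 r1 => k {}n {}d {}r s ku su ur nE hl nl kl nJ d3 r1.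
  have E : (n + u + 2 = h * r.+1 + d)%N by rewrite mulnS; lia.
  have lhd : (l + 2 <= h + d)%N by lia.
  (* An upper bound on [l] turns [nJ] into a lower bound on [N]; the factor [r + 1] lets [E]
     eliminate [h * (r + 1)]. *)
  have : (l * r.+2 * r.+1 + 2 * r.+2 * r.+1 <= r.+2 * (h * r.+1) + d * r.+2 * r.+1)%N.
    by have := leq_mul lhd (leqnn (r.+2 * r.+1)); lia.
  have : (r.+2 * u + r.+2 <= r.+2 * r)%N by have := leq_mul (leqnn r.+2) ur; lia.
  have : (2 * n * r.+1 <= (N + l * r.+2) * r.+1)%N by rewrite leq_mul2r nJ orbT.
  case: d {nE E lhd} d3 (congr1 (muln r.+2) E) => // d _; rewrite subn1 /=; lia.
Qed.

(** * Real bounds *)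

From mathcomp Require Import all_classical all_reals all_analysis.
Import numFieldNormedType.Exports.

Lemma rem1_gt0 (k r : nat) : (0 < r)%N -> (0 < rem1 k r)%N.
Proof. by move=> r0; rewrite /rem1; case: (boolP (r %| k)%N) => // rk; rewrite lt0n. Qed.

Lemma rem1_congr (k r j : nat) : (j < r)%N -> (r %| k + j)%N ->
  (rem1 k r + j = r)%N.
Proof.
move=> jr rkj; rewrite /rem1; case: (boolP (r %| k)%N) => rk.
  by move: rkj; rewrite dvdn_addr // => /dvdn_leq; case: j jr => [|j]; lia.
have := divn_eq k r; have : (k %% r < r)%N by rewrite ltn_mod; lia.
move: rk; rewrite /dvdn => k0 kr kE.
have : (r %| k %% r + j)%N.
  by move: rkj; rewrite {1}kE -addnA dvdn_addr // dvdn_mull.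
case/dvdnP=> x xE; case: x xE => [|[|x]]; rewrite ?mul0n ?mul1n ?mulSn; lia.
Qed.

Lemma congr_opp (k r j : nat) : (k%:Z == - j%:Z %[mod r%:Z])%Z -> (r %| k + j)%N.
Proof. by rewrite eqz_mod_dvd opprK. Qed.

(** The case [e = 1] of the packing bound: [(N - b) * (q - 1) <= q ^ (M + 1)], and
    [q <= 2 * (q - 1)] removes one power of [q]. *)
Lemma opt_lrc_pow_bound (c : opt_lrc) (b M : nat) :
  let r := lrc_r c in let d := lrc_d c in
  (2 * (2 + b) < d)%N ->
  (forall m, (m + 2 <= d)%N -> (r.+1 * m + rem1 (lrc_k c) r <= r * (d - 1))%N ->
     (m <= M + 1 + b)%N) ->
  (lrc_n c <= 2 * (b + 2 * lrc_q c ^ M) + (r + 2) * (d - 1))%N.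
Proof.
move=> r d bd mM; have [N [m [nN m1 m2 ham]]] := opt_lrc_hamming c.
have {m1 m2}mM : (m <= M + 1 + b)%N by apply: mM.
have r1 : (1 <= r)%N by have [] := lrc_axiom c.
have q2 : (2 <= lrc_q c)%N by exact: finNzRing_gt1.
have NM : (N <= b + 2 * lrc_q c ^ M)%N.
  have [/ltnW Nb|bN] := ltnP N b; first by rewrite (leq_trans Nb) ?leq_addr.
  have := ham 1%N b bd bN; rewrite bin1 expn1.
  move=> /leq_trans/(_ (leq_pexp2l (ltnW q2) mM)).
  rewrite expnD leq_pmul2r ?expn_gt0 ?(ltnW q2) // addn1 expnSr.
  have : (lrc_q c <= 2 * (lrc_q c).-1)%N by lia.
  rewrite -(leq_pmul2l (_ : 0 < lrc_q c ^ M)%N) ?expn_gt0 ?(ltnW q2) // => h1 /leq_trans/(_ h1).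
  by rewrite mulnA leq_pmul2r; lia.
rewrite -(leq_pmul2l r1); apply: leq_trans nN _.
have : (r.+1 * N <= (2 * r) * (b + 2 * lrc_q c ^ M))%N by apply: leq_mul; lia.
by move: (b + _)%N (d - 1)%N => X d'; lia.
Qed.

(** After multiplication by [e!] the two products compare factor by factor:
    [n * (e - i) <= e * (n - i)]. *)
Lemma expn_leq_bin (n e : nat) : (e <= n)%N -> (n ^ e <= e ^ e * 'C(n, e))%N.
Proof.
move=> en; rewrite -(leq_pmul2r (fact_gt0 e)) -mulnA bin_ffact -ffactnn.
have powE x : (x ^ e = \prod_(i < e) x)%N by rewrite prod_nat_const card_ord.
rewrite !ffact_prod !powE -!big_split /=.
by apply: leq_prod => i _; rewrite !mulnBr [(e * n)%N]mulnC leq_sub2l // leq_mul2r en orbT.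
Qed.

(** The main term of the bound for [dr = o(n)]. The parameter [b] merges its two cases: 0 for [d]
    congruent to 1 or 2 modulo 4, and 1 for 3 or 4. *)
Definition hamming_length (R : realType) (c : opt_lrc) (b : nat) : R :=
  let q := (lrc_q c)%:R : R in
  let r := (lrc_r c)%:R : R in
  let d := (lrc_d c)%:R : R in
  let t := (rem1 (lrc_d c) 4)%:R : R in
  let eps := (rem1 (lrc_k c) (lrc_r c))%:R / r : R in
  ((r + 1) / r) * ((d - 1) / (4 * (q - 1))) *
    Num.min (q `^ ((4 * r * (d - b.+1%:R - eps)) / ((d - t) * (r + 1))))
            (q `^ ((4 * (d - b.+2%:R)) / (d - t))).

Lemma lrc_q_gt1 (c : opt_lrc) : (1 < lrc_q c)%N.
Proof. exact: finNzRing_gt1. Qed.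

Lemma hamming_length_gt0 (R : realType) (c : opt_lrc) (b : nat) :
  0 < hamming_length R c b.
Proof.
have q1 := lrc_q_gt1 c; have d3 := lrc_d_ge3 c.
have r0 : 0 < (lrc_r c)%:R :> R by rewrite ltr0n; have [] := lrc_axiom c.
have q0 : 0 < (lrc_q c)%:R :> R by rewrite ltr0n; lia.
have q1' : 1 < (lrc_q c)%:R :> R by rewrite ltr1n.
have d1 : 1 < (lrc_d c)%:R :> R by rewrite ltr1n; lia.
apply: mulr_gt0; last by rewrite lt_min !powR_gt0.
by rewrite !mulr_gt0 ?invr_gt0 ?mulr_gt0 ?subr_gt0 ?addr_gt0.
Qed.

Lemma rem1_mod4 (d : nat) : (5 <= d)%N ->
  exists e, [/\ (1 <= e)%N, (d = 4 * e + rem1 d 4)%N, (0 < rem1 d 4)%N & (rem1 d 4 <= 4)%N].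
Proof.
move=> d5; exists ((d - rem1 d 4) %/ 4)%N; rewrite /rem1.
by case: (boolP (4 %| d)%N); rewrite /dvdn => d4; split; lia.
Qed.

(** The packing bound with [e = (d - t) / 4], after an [e]-th root. The error is kept explicit in
    terms of [d * r / n]. *)
Lemma hamming_length_bound (R : realType) (c : opt_lrc) (b : nat) :
  (5 <= lrc_d c)%N -> (b <= 1)%N -> (2 * b < rem1 (lrc_d c) 4)%N ->
  (8 * (lrc_d c * lrc_r c) <= lrc_n c)%N ->
  (lrc_n c)%:R <= (1 + 8 * ((lrc_d c)%:R * (lrc_r c)%:R / (lrc_n c)%:R))
                  * hamming_length R c b.
Proof.
move=> d5 b1 bt small; have [e [e1 dE _ _]] := rem1_mod4 d5.
rewrite /hamming_length; set s := rem1 (lrc_k c) _; set t := rem1 (lrc_d c) 4 in dE bt *.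
have [N [m [nN m1 m2 ham]]] := opt_lrc_hamming c; rewrite -/s in m2.
have r1 : (1 <= lrc_r c)%N by have [] := lrc_axiom c.
have q2 := lrc_q_gt1 c.
move: (lrc_n c) (lrc_d c) (lrc_r c) (lrc_q c) d5 small dE r1 q2 nN m1 m2 ham
  => n d r q d5 small dE r1 q2 nN m1 m2 ham.
(* Otherwise [N < d], and [nN] would bound [r * n] by [5 * r * r * d], against [n >= 8 * d * r]. *)
have NE : (e + b <= N)%N.
  rewrite leqNgt; apply/negP=> Nlow.
  have : (r * n <= r.+1 * d + r * (r + 2) * d)%N.
    apply: leq_trans nN _; apply: leq_add; apply: leq_mul; lia.
  have : (r * (8 * (d * r)) <= r * n)%N by rewrite leq_mul2l small orbT.
  have : (r * d <= r * r * d)%N by rewrite leq_mul2r leq_pmull ?orbT.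
  have : (1 * d <= r * d)%N by rewrite leq_mul2r r1 orbT.
  lia.
have ebd : (2 * (2 * e + b) < d)%N by lia.
have {}ham := ham e b ebd (leq_trans (leq_addl _ _) NE).
have bm : (b <= m)%N.
  rewrite -(leq_exp2l _ _ q2); apply: leq_trans ham.
  rewrite leq_pmull // muln_gt0 bin_gt0 expn_gt0; lia.
have {}ham : (((N - b) * q.-1) ^ e <= e ^ e * q ^ (m - b))%N.
  rewrite expnMn; apply: (@leq_trans (e ^ e * 'C(N - b, e) * q.-1 ^ e)).
    by rewrite leq_mul2r expn_leq_bin ?orbT //; lia.
  rewrite -mulnA leq_mul2l; apply/orP; right.
  rewrite -(@leq_pmul2r (q ^ b)) ?expn_gt0 ?(ltnW q2) //.
  by apply: leq_trans ham _; rewrite -expnD subnK.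
have [P PE] : exists P, (N = P + b)%N by exists (N - b)%N; lia.
rewrite PE addnK in ham.
have e0 : 0 < e%:R :> R by rewrite ltr0n.
have q1 : 1 < q%:R :> R by rewrite ltr1n.
have q10 : 0 < q%:R - 1 :> R by rewrite subr_gt0.
have r0 : 0 < r%:R :> R by rewrite ltr0n.
have ER (x y z : nat) : (x + y <= z)%N -> x%:R <= z%:R - y%:R :> R.
  by move=> xyz; rewrite lerBrDr -natrD ler_nat.
have dt : d%:R - t%:R = 4 * e%:R :> R by rewrite dE natrD addrK natrM.
have PZ z : (m - b)%:R / e%:R <= z -> P%:R <= (e%:R / (q%:R - 1)) * q%:R `^ z :> R.
  move=> hz; apply: (@le_trans _ _ (e%:R / (q%:R - 1) * q%:R `^ ((m - b)%:R / e%:R))).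
    rewrite mulrAC ler_pdivlMr // -ler_pdivrMl // mulrC.
    set y := P%:R * _ / _.
    have y0 : 0 <= y by rewrite /y divr_ge0 ?mulr_ge0 ?ler0n // ltW.
    have -> : y = (y ^+ e) `^ e%:R^-1.
      by rewrite -powR_mulrn // -powRrM mulfV ?gt_eqF // powRr1.
    rewrite [q%:R `^ _]powRrM; apply: ge0_ler_powR.
    - by rewrite invr_ge0 ler0n.
    - by rewrite nnegrE exprn_ge0.
    - by rewrite nnegrE powR_ge0.
    rewrite powR_mulrn ?ler0n // expr_div_n ler_pdivrMr ?exprn_gt0 //.
    have -> : P%:R * (q%:R - 1) = (P * q.-1)%:R :> R.
      by rewrite natrM -subn1 natrB // ltnW.
    by rewrite -!natrX -natrM ler_nat [X in (_ <= X)%N]mulnC.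
  rewrite ler_pM2l ?divr_gt0 //; apply: ler_powR => //; exact: ltW.
set Z := Num.min _ _.
(* The bounds [m2] and [m1] on [m] give the first and second exponent of the minimum; the prefactor
   uses [4 * e <= d - 1]. *)
have PY : P%:R <= (d%:R - 1) / (4 * (q%:R - 1)) * Z.
  have PZ' : P%:R <= (e%:R / (q%:R - 1)) * Z.
    rewrite /Z /Num.min; case: ifP => _; apply: PZ.
    - have r10 : 0 < r%:R + 1 :> R by rewrite addr_gt0.
      have -> : 4 * r%:R * (d%:R - b.+1%:R - s%:R / r%:R) / ((d%:R - t%:R) * (r%:R + 1))
              = (r%:R * (d%:R - b.+1%:R) - s%:R) / (r%:R + 1) / e%:R :> R.
        by rewrite dt; field; rewrite !gt_eqF.
      rewrite ler_pM2r ?invr_gt0 // ler_pdivlMr // natrB // -addn1 natrD.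
      have : (r.+1 * m + s)%:R <= (r * (d - 1))%:R :> R by rewrite ler_nat.
      rewrite natrD !natrM natrB; last by lia.
      rewrite -addn1 natrD; have : 0 <= b%:R :> R by rewrite ler0n.
      by move=> *; lra.
    - have -> : 4 * (d%:R - b.+2%:R) / (d%:R - t%:R) = (d%:R - b.+2%:R) / e%:R :> R.
        by rewrite dt; field; rewrite gt_eqF.
      by rewrite ler_pM2r ?invr_gt0 //; apply: ER; lia.
  apply: le_trans PZ' _; rewrite ler_wpM2r //.
    by rewrite /Z le_min !powR_ge0.
  rewrite invfM mulrA ler_wpM2r ?invr_ge0 ?(ltW q10) // ler_pdivlMr // mulrC.
  by rewrite -natrM; apply: (ER _ 1%N); lia.
set B := (r%:R + 1) / r%:R * _ * _.
have AB : (r%:R + 1) / r%:R * P%:R <= B.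
  by rewrite /B -[X in _ <= X]mulrA ler_pM2l // divr_gt0 // addr_gt0.
have nA : n%:R <= (r%:R + 1) / r%:R * P%:R + 4 * (d%:R * r%:R) :> R.
  rewrite -(ler_pM2l r0) mulrDr !mulrA [r%:R * _ / _]mulrC mulrA mulVf ?gt_eqF // mul1r.
  have : (r * n <= r.+1 * P + r * 4 * d * r)%N.
    have [d' dd] : exists d', d = d'.+1 by exists d.-1; lia.
    have d'r : (d' <= d' * r)%N by rewrite leq_pmulr.
    have rb : (r.+1 * b <= r.+1 * 1)%N by rewrite leq_mul2l.
    have : (r * (2 + (r + 2) * d') <= r * (4 * d * r))%N.
      by rewrite leq_mul2l dd; lia.
    by move: nN; rewrite PE mulnDr dd subn1 /=; lia.
  by rewrite -(ler_nat R) natrD !natrM -addn1 natrD.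
have n0 : 0 < n%:R :> R by rewrite ltr0n; nia.
set x := d%:R * r%:R / n%:R.
have xn : d%:R * r%:R = x * n%:R by rewrite /x divfK ?gt_eqF.
have x0 : 0 <= x by rewrite /x divr_ge0 ?mulr_ge0 ?ler0n.
have x8 : x <= 8^-1.
  rewrite /x ler_pdivrMr // ler_pdivlMl // -!natrM ler_nat; lia.
have nB : n%:R <= B + 4 * (x * n%:R) by apply: le_trans nA _; rewrite xn lerD2r.
move: x B x0 x8 nB {AB nA xn} n0 => x B x0 x8 nB n0.
(* [(1 + 8 x) (1 - 4 x) >= 1] holds for [0 <= x <= 1/8], which is where the constants 8 come
   from. *)
apply: (@le_trans _ _ ((1 + 8 * x) * (n%:R * (1 - 4 * x)))).
  have : 0 <= n%:R * (x * (8^-1 - x)) by rewrite mulr_ge0 ?mulr_ge0 ?subr_ge0 // ltW.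
  by lra.
by rewrite ler_wpM2l //; lra.
Qed.

(** * Asymptotic forms of the bounds *)

Lemma opt_lrc_linear_d (R : realType) (lambda : R) : 0 < lambda < 1 ->
  length_bigO (fun c => (lrc_d c)%:R = lambda * (lrc_n c)%:R)
              (fun c => (lrc_q c)%:R : R).
Proof.
move=> /andP[l0 _]; exists (2 / lambda) => c dn.
rewrite mulrAC ler_pdivlMr // mulrC -dn -natrM ler_nat.
exact: opt_lrc_d_le_2q.
Qed.

(** The congruence condition makes the remainder at least 2 (it excludes [r = 1]), so [d <= q];
    moreover [n = d + k + h - 2] and [h <= k]. *)
Lemma opt_lrc_fixed_k (c : opt_lrc) : (lrc_k c != 1 %[mod lrc_r c])%N ->
  (lrc_n c <= lrc_q c + 2 * lrc_k c)%N.
Proof.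
move=> k1; have [r1 _ _ _] := lrc_axiom c; have rk := lrc_r_lt_k c.
have s2 : (2 <= rem1 (lrc_k c) (lrc_r c))%N.
  move: k1 r1; rewrite /rem1 /dvdn; case: (lrc_r c) => [|[|r]] // ; first by rewrite !modn1.
  rewrite [(1 %% _)%N]modn_small // => k1 _.
  by case: ifP => // /negbT; lia.
have dq := opt_lrc_d_le_q s2.
have [h [u [ku _ ur nE h2]]] := opt_lrc_params c.
have : (h * 1 <= h * lrc_r c)%N by rewrite leq_mul2l r1 orbT.
have : ((h - 1) * 1 <= (h - 1) * lrc_r c)%N by rewrite leq_mul2l r1 orbT.
by rewrite mulnBl mul1n; lia.
Qed.

Lemma opt_lrc_small_d_real (R : realType) (c : opt_lrc) :
  let n := lrc_n c in let d := lrc_d c in let r := lrc_r c in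
  (r + 2 - rem1 (lrc_k c) r < d < r + 2)%N ->
  n%:R < (d%:R + r%:R) * (r%:R - 1 + (d%:R - 2) * r%:R) / (r%:R - d%:R + 2) :> R.
Proof.
move=> n d r hd; have [r1 _ _ _] := lrc_axiom c; have d3 := lrc_d_ge3 c.
have dr : (d <= r + 2)%N by move: hd; lia.
have -> : r%:R - d%:R + 2 = (r + 2 - d)%:R :> R by rewrite natrB // natrD; ring.
have -> : (d%:R + r%:R) * (r%:R - 1 + (d%:R - 2) * r%:R)
        = ((d + r) * ((d - 1) * r - 1))%:R :> R.
  rewrite natrM natrD natrB ?natrM ?natrB; [ring|rewrite /d; lia|].
  by rewrite muln_gt0; apply/andP; split; [rewrite /d; lia|exact: r1].
rewrite ltr_pdivlMr -?natrM ?ltr_nat ?ltr0n; last by move: hd; lia.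
exact: opt_lrc_small_d.
Qed.

(** The threshold 18 makes [(r + 2) * 6], which is at most [9 * r] for [r >= 4], at most half of the
    length. *)
Lemma small_r_near (R : realType) (s : nat -> opt_lrc) :
  (((lrc_r (s i))%:R / (lrc_n (s i))%:R : R) @[i --> \oo] --> (0 : R))%classic ->
  (\forall i \near \oo, (18 * lrc_r (s i) <= lrc_n (s i))%N)%classic.
Proof.
move=> /cvgr0Pnorm_lt/(_ 18^-1); rewrite invr_gt0 ltr0n => /(_ isT).
apply: filterS => i; rewrite ger0_norm ?divr_ge0 ?ler0n //.
have n0 : 0 < (lrc_n (s i))%:R :> R by rewrite ltr0n; have := lrc_n_ge (s i); lia.
by rewrite ltr_pdivrMr // ltr_pdivlMl // -natrM ltr_nat => /ltnW.
Qed.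

(** Eventually the term in [r] is at most [n / 2], so [n <= 4 * b + 8 * q ^ M <= 12 * q ^ M]. *)
Lemma length_bigO_small_r_pow (R : realType) (P : opt_lrc -> Prop) (b M : nat)
    (f : opt_lrc -> R) : (b <= 1)%N ->
  (forall c, P c -> (4 <= lrc_r c)%N /\
     (lrc_n c <= 2 * (b + 2 * lrc_q c ^ M) + (lrc_r c + 2) * 6)%N) ->
  (forall c, P c -> (lrc_q c ^ M)%:R <= f c) ->
  length_bigO_small_r P f.
Proof.
move=> b1 Pn Pf; exists 12 => s Ps /small_r_near; apply: filterS => i ri.
have [r4 nB] := Pn _ (Ps i).
apply: (@le_trans _ _ (12 * (lrc_q (s i) ^ M)%:R)); last by rewrite ler_pM2l ?Pf.
rewrite -natrM ler_nat.
have : (1 <= lrc_q (s i) ^ M)%N by rewrite expn_gt0 (ltnW (lrc_q_gt1 _)).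
by lia.
Qed.

Lemma congr_any_opp (k r : nat) (m : nat) (js : seq nat) :
  (m < r)%N -> all (fun j => j <= m)%N js ->
  congr_any k r [seq - j%:Z | j <- js] -> (r <= rem1 k r + m)%N.
Proof.
move=> mr jm /hasP[_ /mapP[j jjs ->]] /congr_opp kj.
have {}jm := allP jm _ jjs.
by rewrite -{1}(rem1_congr (leq_ltn_trans jm mr) kj) leq_add2l.
Qed.

(** The residues make the remainder at least [r - (D - 3)], exactly what [opt_lrc_small_d] requires
    when [d = D]. *)
Lemma opt_lrc_bigO_r (R : realType) (D : nat) (js : seq nat) : (3 < D)%N ->
  all (fun j => j <= D - 3)%N js ->
  length_bigO (fun c => [/\ lrc_d c = D, (D - 1 <= lrc_r c)%N &
                 congr_any (lrc_k c) (lrc_r c) [seq - j%:Z | j <- js]])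
              (fun c => (lrc_r c)%:R : R).
Proof.
move=> D3 jD; exists ((2 * D) * D)%:R => c [dD rD /congr_any_opp kr].
have {}kr : (lrc_r c <= rem1 (lrc_k c) (lrc_r c) + (D - 3))%N by apply: kr => //; lia.
rewrite -natrM ler_nat; have := @opt_lrc_small_d c.
rewrite /= dD => /(_ _)/ltnW; set r := lrc_r c in rD kr *.
have -> : (r + 2 - rem1 (lrc_k c) r < D < r + 2)%N by apply/andP; split; lia.
move=> /(_ isT) nB.
rewrite -(@leq_pmul2r (r + 2 - D)); last by lia.
apply: leq_trans nB _.
(* The denominator is absorbed by [D + r <= 2 * D * (r + 2 - D)]. *)
have -> : (2 * D * D * r * (r + 2 - D) = (2 * D * (r + 2 - D)) * (D * r))%N by lia.
apply: leq_mul; last by rewrite (leq_trans (leq_subr _ _)) // leq_mul2r leq_subr orbT.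
have [x rx] : exists x, (r + 2 = D + x.+1)%N by exists (r + 1 - D)%N; lia.
have -> : (r + 2 - D = x.+1)%N by lia.
have : (x <= D * x)%N by rewrite leq_pmull //; lia.
by lia.
Qed.

(** For these small parameters [(r + 2) * (d - 1) <= 42], and 48 is [42 + 4 + 2]. *)
Lemma opt_lrc_bigO_pow (R : realType) (P : opt_lrc -> Prop) (b M : nat) : (b <= 1)%N ->
  (forall c, P c -> [/\ (2 * (2 + b) < lrc_d c)%N, (lrc_d c <= 7)%N, (lrc_r c <= 5)%N &
     forall m, (m + 2 <= lrc_d c)%N ->
       ((lrc_r c).+1 * m + rem1 (lrc_k c) (lrc_r c) <= lrc_r c * (lrc_d c - 1))%N ->
       (m <= M + 1 + b)%N]) ->
  length_bigO P (fun c => (lrc_q c)%:R ^+ M : R).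
Proof.
move=> b1 Pc; exists 48 => c /Pc[bd d7 r5 mM].
rewrite -natrX -natrM ler_nat; have := opt_lrc_pow_bound bd mM.
have : (1 <= lrc_q c ^ M)%N by rewrite expn_gt0 (ltnW (lrc_q_gt1 _)).
have : ((lrc_r c + 2) * (lrc_d c - 1) <= 7 * 6)%N by apply: leq_mul; lia.
by move: (_ * (_ - _))%N (_ ^ _)%N (lrc_n c) => x y n; lia.
Qed.

(** One sequence [o1] has to serve both values of [b]. It equals [8 * x i] wherever
    [hamming_length_bound] applies, which is the case from some index on. *)
Lemma hamming_asymptotic (R : realType) (s : nat -> opt_lrc) :
  (forall i, (5 <= lrc_d (s i))%N) ->
  (((lrc_d (s i))%:R * (lrc_r (s i))%:R / (lrc_n (s i))%:R : R)
       @[i --> \oo] --> (0 : R))%classic ->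
  exists o1 : nat -> R, (o1 i @[i --> \oo] --> (0 : R))%classic /\
    forall i (b : nat), (b <= 1)%N -> (2 * b < rem1 (lrc_d (s i)) 4)%N ->
      (lrc_n (s i))%:R <= (1 + o1 i) * hamming_length R (s i) b.
Proof.
move=> d5 hx; pose x i := (lrc_d (s i))%:R * (lrc_r (s i))%:R / (lrc_n (s i))%:R : R.
have n0 i : 0 < (lrc_n (s i))%:R :> R by rewrite ltr0n; have := lrc_n_ge (s i); lia.
have x0 i : 0 <= x i by rewrite divr_ge0 ?mulr_ge0 ?ler0n.
pose small i := (8 * (lrc_d (s i) * lrc_r (s i)) <= lrc_n (s i))%N.
(* Finitely many terms may violate [small]; there o1 just makes the bound hold. *)
pose o1 i := if small i then 8 * x i else
  \sum_(b < 2) (lrc_n (s i))%:R / hamming_length R (s i) b.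
exists o1; split.
  apply/cvgr0Pnorm_lt => e e0.
  have := hx => /cvgr0Pnorm_lt/(_ (Num.min (e / 8) 8^-1)).
  rewrite lt_min divr_gt0 // invr_gt0 ltr0n => /(_ isT); apply: filterS => i.
  rewrite -/(x i) ger0_norm // lt_min => /andP[xe x8].
  have si : small i.
    by move: x8; rewrite ltr_pdivrMr // ltr_pdivlMl // -!natrM ltr_nat => /ltnW.
  by rewrite /o1 si ger0_norm ?mulr_ge0 // mulrC -ltr_pdivlMr.
move=> i b b1 bt; rewrite /o1; case: (boolP (small i)) => si.
  exact: hamming_length_bound.
have hb := hamming_length_gt0 R (s i) b.
have b2 : (b < 2)%N by [].
rewrite -ler_pdivrMr // (bigD1 (Ordinal b2)) //= addrCA lerDl addr_ge0 //.
by apply: sumr_ge0 => j _; rewrite divr_ge0 ?ler0n // ltW // hamming_length_gt0.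
Qed.

(** * Assembly of the five statements *)

Local Open Scope classical_set_scope.
Local Open Scope ring_scope.

Theorem theorem1p4 (R : realType) :
  (* (i) *)
  (forall lambda : R, 0 < lambda < 1 ->
     length_bigO (fun c => (lrc_d c)%:R = lambda * (lrc_n c)%:R)
                 (fun c => (lrc_q c)%:R : R))
  /\
  (* (ii) *)
  (main_MDS_conjecture ->
   forall k : nat, exists K : nat, forall c : opt_lrc,
     lrc_k c = k -> k <> 1 %[mod lrc_r c] ->
     (lrc_n c <= lrc_q c + K)%N)
  /\
  (* (iii) *)
  ((forall c : opt_lrc,
      let n := lrc_n c in let k := lrc_k c in
      let d := lrc_d c in let r := lrc_r c in
      (r + 2 - rem1 k r < d < r + 2)%N ->
      n%:R < (d%:R + r%:R) * (r%:R - 1 + (d%:R - 2) * r%:R)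
             / (r%:R - d%:R + 2) :> R)
   /\
   (forall r d : nat,
      length_bigO (fun c => [/\ lrc_r c = r, lrc_d c = d &
                     (r + 2 - rem1 (lrc_k c) r < d < r + 2)%N])
                  (fun _ => 1 : R)))
  /\
  (* (iv) *)
  (forall s : nat -> opt_lrc,
     (forall i, (5 <= lrc_d (s i))%N) ->
     ((lrc_d (s i))%:R * (lrc_r (s i))%:R / (lrc_n (s i))%:R : R)
       @[i --> \oo] --> (0 : R) ->
     exists o1 : nat -> R, (o1 i @[i --> \oo] --> (0 : R)) /\
       forall i : nat,
         let q := (lrc_q (s i))%:R : R in
         let n := (lrc_n (s i))%:R : R in
         let r := (lrc_r (s i))%:R : R in
         let d := (lrc_d (s i))%:R : R in
         let t := (rem1 (lrc_d (s i)) 4)%:R : R in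
         let eps := (rem1 (lrc_k (s i)) (lrc_r (s i)))%:R / r : R in
         (congr_any (lrc_d (s i)) 4 [:: 1; 2] ->
            n <= (1 + o1 i) * ((r + 1) / r) * ((d - 1) / (4 * (q - 1))) *
                 Num.min
                   (q `^ ((4 * r * (d - 1 - eps)) / ((d - t) * (r + 1))))
                   (q `^ ((4 * (d - 2)) / (d - t))))
         /\
         (congr_any (lrc_d (s i)) 4 [:: 3; 4] ->
            n <= (1 + o1 i) * ((r + 1) / r) * ((d - 1) / (4 * (q - 1))) *
                 Num.min
                   (q `^ ((4 * r * (d - 2 - eps)) / ((d - t) * (r + 1))))
                   (q `^ ((4 * (d - 3)) / (d - t)))))
  /\
  (* (v), d = 5 *)
  [/\ length_bigO (fun c => lrc_d c = 5%N /\ lrc_r c = 1%N) (fun _ => 1 : R),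
      length_bigO (fun c => lrc_d c = 5%N /\ lrc_r c \in [:: 2; 3]%N)
        (fun c => (lrc_q c)%:R : R),
      length_bigO (fun c => [/\ lrc_d c = 5%N, (4 <= lrc_r c)%N &
                       congr_any (lrc_k c) (lrc_r c) [:: 0; -1; -2]])
        (fun c => (lrc_r c)%:R : R) &
      length_bigO_small_r (fun c => lrc_d c = 5%N /\ (4 <= lrc_r c)%N)
        (fun c => (lrc_q c)%:R ^+ 2 : R)]
  /\
  (* (v), d = 6 *)
  ([/\ length_bigO (fun c => lrc_d c = 6%N /\ lrc_r c = 1%N)
         (fun c => (lrc_q c)%:R : R),
       length_bigO (fun c => [/\ lrc_d c = 6%N, lrc_r c = 2%N &
                        congr_any (lrc_k c) 2 [:: 0]])
         (fun c => (lrc_q c)%:R : R) &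
       length_bigO (fun c => [/\ lrc_d c = 6%N, lrc_r c = 2%N &
                        congr_any (lrc_k c) 2 [:: 1]])
         (fun c => (lrc_q c)%:R ^+ 2 : R)]
   /\
   [/\ length_bigO (fun c => lrc_d c = 6%N /\ lrc_r c \in [:: 3; 4]%N)
         (fun c => (lrc_q c)%:R ^+ 2 : R),
       length_bigO (fun c => [/\ lrc_d c = 6%N, (5 <= lrc_r c)%N &
                        congr_any (lrc_k c) (lrc_r c) [:: 0; -1; -2; -3]])
         (fun c => (lrc_r c)%:R : R) &
       length_bigO_small_r (fun c => lrc_d c = 6%N /\ (5 <= lrc_r c)%N)
         (fun c => (lrc_q c)%:R `^
            ((4 * (lrc_r c)%:R - 2) / ((lrc_r c)%:R + 1)) : R)])
  /\
  (* (v), d = 7 *)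
  ([/\ length_bigO (fun c => lrc_d c = 7%N /\ lrc_r c = 1%N) (fun _ => 1 : R),
       length_bigO (fun c => lrc_d c = 7%N /\ lrc_r c = 2%N)
         (fun c => (lrc_q c)%:R : R),
       length_bigO (fun c => [/\ lrc_d c = 7%N, lrc_r c = 3%N &
                        congr_any (lrc_k c) 3 [:: 0]])
         (fun c => (lrc_q c)%:R : R) &
       length_bigO (fun c => [/\ lrc_d c = 7%N, lrc_r c = 3%N &
                        ~~ congr_any (lrc_k c) 3 [:: 0]])
         (fun c => (lrc_q c)%:R ^+ 2 : R)]
   /\
   [/\ length_bigO (fun c => lrc_d c = 7%N /\ lrc_r c \in [:: 4; 5]%N)
         (fun c => (lrc_q c)%:R ^+ 2 : R),
       length_bigO (fun c => [/\ lrc_d c = 7%N, (6 <= lrc_r c)%N &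
                        congr_any (lrc_k c) (lrc_r c) [:: -1; -2; -3; -4]])
         (fun c => (lrc_r c)%:R : R) &
       length_bigO_small_r (fun c => lrc_d c = 7%N /\ (6 <= lrc_r c)%N)
         (fun c => (lrc_q c)%:R `^
            ((4 * (lrc_r c)%:R - 2) / ((lrc_r c)%:R + 1)) : R)]).
Proof.
split; first exact: opt_lrc_linear_d.
split.
  move=> _ k; exists (2 * k)%N => c <- /eqP; exact: opt_lrc_fixed_k.
split.
  split; first exact: opt_lrc_small_d_real.
  move=> r d; exists ((d%:R + r%:R) * (r%:R - 1 + (d%:R - 2) * r%:R) / (r%:R - d%:R + 2)).
  by move=> c [<- <- hd]; rewrite mulr1 ltW //; exact: opt_lrc_small_d_real.
split.
  move=> s d5 hx; have [w [w0 bound]] := hamming_asymptotic d5 hx.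
  exists w; split=> // i /=; have [e [_ _ t0 _]] := rem1_mod4 (d5 i).
  split=> [_|d34].
    by have := bound i 0%N isT t0; rewrite /hamming_length /= !mulrA.
  (* Remainder 3 or 4 leaves room for one arbitrary coefficient, so [b = 1]. *)
  have t3 : (2 * 1 < rem1 (lrc_d (s i)) 4)%N.
    by move: d34; rewrite /congr_any /rem1 /dvdn /=; case: ifP => //; lia.
  by have := bound i 1%N isT t3; rewrite /hamming_length /= !mulrA.
have s1 c : (1 <= rem1 (lrc_k c) (lrc_r c))%N by apply: rem1_gt0; have [] := lrc_axiom c.
have s0 (k r : nat) : (1 < r)%N -> congr_any k r [:: 0] -> (r <= rem1 k r)%N.
  move=> r1 /(@congr_any_opp k r 0 [:: 0%N]); rewrite addn0; apply=> //; lia.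
(* [3 <= (4 r - 2) / (r + 1)] is equivalent to [r >= 5], so a bound of order [q ^ 3] suffices. *)
have q3 c : (5 <= lrc_r c)%N -> ((lrc_q c ^ 3)%:R : R) <=
    (lrc_q c)%:R `^ ((4 * (lrc_r c)%:R - 2) / ((lrc_r c)%:R + 1)).
  move=> r5; rewrite natrX -powR_mulrn ?ler0n //; apply: ler_powR.
    by rewrite ler1n ltnW // lrc_q_gt1.
  have : 5 <= (lrc_r c)%:R :> R by rewrite (ler_nat R 5).
  by move=> r5R; rewrite ler_pdivlMr; lra.
split.
  split.
  (* For fixed [r], the exponent is [M = m - 1 - b] for the largest [m] with
     [(r + 1) * m + s <= r * (d - 1)], where [s] is the least possible remainder; [b] is 1 only for
     [d = 7]. *)
  - apply: (@opt_lrc_bigO_pow R _ 0 0) => // c [-> rE].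
    by have := s1 c; rewrite rE => s1c; split=> // m; lia.
  - apply: (@opt_lrc_bigO_pow R _ 0 1) => // c [-> hr].
    have [rE|rE] : lrc_r c = 2%N \/ lrc_r c = 3%N.
    + by move: hr; rewrite !inE => /orP[] /eqP; auto.
    + by have := s1 c; rewrite rE => s1c; split=> // m; lia.
    + by have := s1 c; rewrite rE => s1c; split=> // m; lia.
  - exact: (@opt_lrc_bigO_r R 5 [:: 0; 1; 2]%N).
  (* For unbounded [r] the exponent comes from [m <= d - 2]. *)
  - apply: (@length_bigO_small_r_pow R _ 0 2) => // c [dE r4]; last by rewrite natrX.
    split=> //; have := @opt_lrc_pow_bound c 0 2; rewrite /= dE => nB.
    by apply: leq_trans (nB isT _) _ => [m|]; lia.
split.
  split; split.
  - apply: (@opt_lrc_bigO_pow R _ 0 1) => // c [-> rE].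
    by have := s1 c; rewrite rE => s1c; split=> // m; lia.
  (* For even [k] the remainder is 2 rather than 1, which lowers the largest [m] from 3 to 2. *)
  - apply: (@opt_lrc_bigO_pow R _ 0 1) => // c [-> rE /s0] /(_ isT).
    by rewrite rE => s2; split=> // m; lia.
  - apply: (@opt_lrc_bigO_pow R _ 0 2) => // c [-> rE _].
    by have := s1 c; rewrite rE => s1c; split=> // m; lia.
  - apply: (@opt_lrc_bigO_pow R _ 0 2) => // c [-> hr].
    have [rE|rE] : lrc_r c = 3%N \/ lrc_r c = 4%N.
    + by move: hr; rewrite !inE => /orP[] /eqP; auto.
    + by have := s1 c; rewrite rE => s1c; split=> // m; lia.
    + by have := s1 c; rewrite rE => s1c; split=> // m; lia.
  - exact: (@opt_lrc_bigO_r R 6 [:: 0; 1; 2; 3]%N).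
  - apply: (@length_bigO_small_r_pow R _ 0 3) => // c [dE r5]; last exact: q3.
    split; first exact: ltnW.
    have := @opt_lrc_pow_bound c 0 3; rewrite /= dE => nB.
    by apply: leq_trans (nB isT _) _ => [m|]; lia.
split; split.
- apply: (@opt_lrc_bigO_pow R _ 1 0) => // c [-> rE].
  by have := s1 c; rewrite rE => s1c; split=> // m; lia.
- apply: (@opt_lrc_bigO_pow R _ 1 1) => // c [-> rE].
  by have := s1 c; rewrite rE => s1c; split=> // m; lia.
(* Divisibility by 3 makes the remainder 3, so [m <= 3]; in general only [m <= 4] holds. *)
- apply: (@opt_lrc_bigO_pow R _ 1 1) => // c [-> rE /s0] /(_ isT).
  by rewrite rE => s3; split=> // m; lia.
- apply: (@opt_lrc_bigO_pow R _ 1 2) => // c [-> rE _].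
  by have := s1 c; rewrite rE => s1c; split=> // m; lia.
- apply: (@opt_lrc_bigO_pow R _ 1 2) => // c [-> hr].
  have [rE|rE] : lrc_r c = 4%N \/ lrc_r c = 5%N.
  + by move: hr; rewrite !inE => /orP[] /eqP; auto.
  + by have := s1 c; rewrite rE => s1c; split=> // m; lia.
  + by have := s1 c; rewrite rE => s1c; split=> // m; lia.
- exact: (@opt_lrc_bigO_r R 7 [:: 1; 2; 3; 4]%N).
- apply: (@length_bigO_small_r_pow R _ 1 3) => // c [dE r6]; last exact/q3/ltnW.
  split; first by do 2!apply: ltnW.
  have := @opt_lrc_pow_bound c 1 3; rewrite /= dE => nB.
  by apply: leq_trans (nB isT _) _ => [m|]; lia.
Qed.
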